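(* The functor $H_*^{\Delta,h}$ is invariant under weak local strong $h$-homotopy equivalence of quivers: if quivers $G_1$ and $G_2$ satisfy $G_1\simeq^{wlSh}G_2$, then $H_*^{\Delta,h}(G_1)\cong H_*^{\Delta,h}(G_2)$ as graded modules.
   Context: A quiver $G=(V_G,E_G,s_G,t_G)$ consists of a non-empty set $V_G$ of vertices, a set $E_G$ of edges and functions $s_G,t_G\colon E_G\to V_G$. A homomorphism $G\to G'$ is a pair of functions $V_G\to V_{G'}$, $E_G\to E_{G'}$ commuting with source and target. A subquiver $H$ of $G$ has $V_H\subseteq V_G$, $E_H\subseteq E_G$ with restricted source and target; it is full if $E_H=\{e\in E_G\mid s_G(e),t_G(e)\in V_H\}$. A loop at $v$ is an edge with source and target $v$; a vertex has a loop if there is a loop at it. An edge $e$ is a multiple edge if there is another edge $e'\ne e$ with the same source and the same target. An edge $e$ with $s(e)\neq t(e)$ is a double edge if there is an edge from $t(e)$ to $s(e)$. $R$ is a fixed commutative ring. $\Delta^n$ is the quiver with vertices $0,\dots,n$ and exactly one edge $a\to b$ for each $a<b$ (no other edges); for $n\ge 1$ and $0\le i\le n$, $\delta_i\colon\Delta^{n-1}\to\Delta^n$ is the unique homomorphism with $\delta_i(j)=j$ for $j<i$ and $\delta_i(j)=j+1$ otherwise. $C_n^{\Delta,h}(G)$ is the free $R$-module on homomorphisms $f\colon\Delta^n\to G$, with differential given by $\partial_n(f)=\sum_{i=0}^n(-1)^if\circ\delta_i$ for $n\ge 1$; $H_*^{\Delta,h}(G)$ is the homology of this chain complex. A homomorphism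 $\phi$ of quivers induces a map on homology via $f\mapsto\phi\circ f$. For a full subquiver $G'$ of $G$, the strong mapping cylinder $M^S_{G'\hookrightarrow G}$ is the quiver with vertices $(V_G\times\{0\})\cup(V_{G'}\times\{1\})$ and the following edges: $(e,0)$ for $e\in E_G$, from $(s(e),0)$ to $(t(e),0)$; $(e,1)$ for $e\in E_{G'}$, from $(s(e),1)$ to $(t(e),1)$; $(v,0\to1)$ for $v\in V_{G'}$, from $(v,0)$ to $(v,1)$; $(e,0\to1)$ for $e\in E_{G'}$, from $(s(e),0)$ to $(t(e),1)$; and $e_{e_G}$ for each $e_G\in E_G$ having exactly one of $s(e_G),t(e_G)$ in $V_{G'}$, whose source is $(s(e_G),1)$ if $s(e_G)\in V_{G'}$ and $(s(e_G),0)$ otherwise, and whose target is $(t(e_G),1)$ if $t(e_G)\in V_{G'}$ and $(t(e_G),0)$ otherwise. Define $i_0,i_1\colon G\to M^S_{G'\hookrightarrow G}$ by $i_0(v)=(v,0)$, $i_0(e)=(e,0)$; $i_1(v)=(v,1)$ if $v\in V_{G'}$ and $(v,0)$ otherwise; $i_1(e)=(e,1)$ if $e\in E_{G'}$, $i_1(e)=(e,0)$ if neither $s(e)$ nor $t(e)$ lies in $V_{G'}$, and $i_1(e)=e_e$ otherwise. For $f_0,f_1\colon G\to H$ write $f_0\simeq_1^{lSh}f_1$ if there are a full subquiver $G'$ of $G$ and a homomorphism $F\colon M^S_{G'\hookrightarrow G}\to H$ with $F\circ i_0=f_0$, $F\circ i_1=f_1$. A loop $l$ at a vertex $v$ of $G$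 is degenerate if it is the unique loop at $v$ and for every $u\in V_G$, $u\ne v$, and every edge $e$ from $u$ to $v$ or from $v$ to $u$, the edge $e$ is not a multiple edge, and either (i) $u$ has a loop or (ii) $e$ is not a double edge. A loop contraction of $G$ is a subquiver obtained from $G$ by removing one or more degenerate loops of $G$ from $E_G$. Quivers $G_1,G_2$ are $1$-step weak local strong $h$-homotopy equivalent if (1) there are homomorphisms $f\colon G_1\to G_2$ and $g\colon G_2\to G_1$ with $g\circ f\simeq_1^{lSh}\mathrm{id}_{G_1}$ and $f\circ g\simeq_1^{lSh}\mathrm{id}_{G_2}$; or (2) $G_1$ is a loop contraction of $G_2$; or (3) $G_2$ is a loop contraction of $G_1$. The relation $\simeq^{wlSh}$ (weak local strong $h$-homotopy equivalence) is the equivalence relation on quivers generated by (1), (2) and (3).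
   Formalization: A loop contraction removes loops successively: each removed loop must be degenerate in G and also after all the other chosen loops are removed; simultaneous removal of loops degenerate only in G can change H_1 (two looped vertices joined by edges both ways). *)

(* Defs.v *)
From HB Require Import structures.
From mathcomp Require Import all_boot all_algebra generic_quotient ring_quotient.
From mathcomp Require Import finmap boolp zify.
From mathcomp.multinomials Require Import monalg.
From Stdlib Require Export Relation_Operators.

Set Implicit Arguments.
Unset Strict Implicit.
Unset Printing Implicit Defensive.

Import GRing.Theory.
Local Open Scope ring_scope.
Local Open Scope quotient_scope.

Record quiver := Quiver {
  vertex : Type;
  edge : Type;
  src : edge -> vertex;
  tgt : edge -> vertex;
  vertex_inhabited : inhabited vertex }.

Arguments src {q} e.
Arguments tgt {q} e.

Record qhom (G H : quiver) := QHom {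
  vmap : vertex G -> vertex H;
  emap : edge G -> edge H;
  src_emap : forall e, src (emap e) = vmap (src e);
  tgt_emap : forall e, tgt (emap e) = vmap (tgt e) }.

HB.instance Definition _ G H := gen_eqMixin (qhom G H).
HB.instance Definition _ G H := gen_choiceMixin (qhom G H).

Lemma qhom_ext (G H : quiver) (f g : qhom G H) :
  vmap f =1 vmap g -> emap f =1 emap g -> f = g.
Proof.
case: f g => [fv fe fs ft] [gv ge gs gt] /= /funext ev /funext ee.
by subst gv ge; congr QHom; apply: Prop_irrelevance.
Qed.

Definition qid (G : quiver) : qhom G G :=
  @QHom G G id id (fun _ => erefl) (fun _ => erefl).

Definition qcomp (G H K : quiver) (g : qhom H K) (f : qhom G H) : qhom G K :=
  @QHom G K (vmap g \o vmap f) (emap g \o emap f)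
    (fun e => etrans (src_emap g (emap f e)) (congr1 (vmap g) (src_emap f e)))
    (fun e => etrans (tgt_emap g (emap f e)) (congr1 (vmap g) (tgt_emap f e))).

Definition qiso (G H : quiver) : Prop :=
  exists (f : qhom G H) (g : qhom H G), qcomp g f = qid G /\ qcomp f g = qid H.

Record subquiver (G : quiver) := Subquiver {
  sub_vertex : vertex G -> Prop;
  sub_edge : edge G -> Prop;
  sub_src : forall e, sub_edge e -> sub_vertex (src e);
  sub_tgt : forall e, sub_edge e -> sub_vertex (tgt e);
  sub_nonempty : exists v, sub_vertex v }.

Definition full_subquiver (G : quiver) (H : subquiver G) : Prop :=
  forall e, sub_edge H e <-> sub_vertex H (src e) /\ sub_vertex H (tgt e).

Definition quiver_of (G : quiver) (H : subquiver G) : quiver :=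
  @Quiver {v | sub_vertex H v} {e | sub_edge H e}
    (fun e => exist _ (src (sval e)) (sub_src (svalP e)))
    (fun e => exist _ (tgt (sval e)) (sub_tgt (svalP e)))
    (let: ex_intro v hv := sub_nonempty H in inhabits (exist _ v hv)).

Definition Delta (n : nat) : quiver :=
  @Quiver 'I_n.+1 {p : 'I_n.+1 * 'I_n.+1 | (p.1 < p.2)%N}
    (fun e => (val e).1) (fun e => (val e).2) (inhabits ord0).

Lemma lift_mono (n : nat) (i : 'I_n.+2) (p : 'I_n.+1 * 'I_n.+1) :
  (p.1 < p.2)%N -> ((lift i p.1, lift i p.2).1 < (lift i p.1, lift i p.2).2)%N.
Proof. by move=> lt12; change (bump i p.1 < bump i p.2)%N; rewrite ltnNge leq_bump2 -ltnNge. Qed.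

(* [lift i] maps j to j if j < i and to j + 1 otherwise. *)
Definition delta (n : nat) (i : 'I_n.+2) : qhom (Delta n) (Delta n.+1) :=
  @QHom (Delta n) (Delta n.+1) (lift i)
    (fun e => exist _ (lift i (val e).1, lift i (val e).2) (lift_mono i (valP e)))
    (fun _ => erefl) (fun _ => erefl).

Lemma delta_delta n (i j : 'I_n.+3) (i' j' : 'I_n.+2) : (j < i)%N ->
  (i' = i.-1 :> nat)%N -> (j' = j :> nat)%N ->
  qcomp (delta i) (delta j') = qcomp (delta j) (delta i').
Proof.
move=> ltji ei ej.
have E (x : 'I_n.+1) : lift i (lift j' x) = lift j (lift i' x).
  apply/val_inj; rewrite /= /bump ej ei.
  by do 4 case: leqP => //=; lia.
apply: qhom_ext => [x|e] /=; first exact: E.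
by apply/val_inj => /=; rewrite !E.
Qed.

(* monalg only equips {malg R[K]} with a module structure over a nontrivial
   ring; here the zero ring is allowed as well. *)
Definition freemod (R : comPzRingType) (K : choiceType) : Type := {malg R[K]}.

Section FreeModule.
Variables (R : comPzRingType) (K : choiceType).

HB.instance Definition _ := GRing.Zmodule.on (freemod R K).

Definition freemod_scale (c : R) (g : freemod R K) : freemod R K :=
  \sum_(k <- msupp g) << c * g@_k *g k >>.

Lemma freemod_scaleE c g k : (freemod_scale c g)@_k = c * g@_k.
Proof.
rewrite {2}[g]monalgE !raddf_sum mulr_sumr.
by apply/eq_bigr=> /= i _; rewrite !mcoeffU mulrnAr.
Qed.

Fact freemod_scaleA a b g :
  freemod_scale a (freemod_scale b g) = freemod_scale (a * b) g.
Proof. by apply/malgP=> k; rewrite !freemod_scaleE mulrA. Qed.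

Fact freemod_scale1 g : freemod_scale 1 g = g.
Proof. by apply/malgP=> k; rewrite !freemod_scaleE mul1r. Qed.

Fact freemod_scaleDr c g1 g2 :
  freemod_scale c (g1 + g2) = freemod_scale c g1 + freemod_scale c g2.
Proof. by apply/malgP=> k; rewrite !(mcoeffD, freemod_scaleE) mulrDr. Qed.

Fact freemod_scaleDl g a b :
  freemod_scale (a + b) g = freemod_scale a g + freemod_scale b g.
Proof. by apply/malgP=> k; rewrite !(mcoeffD, freemod_scaleE) mulrDl. Qed.

HB.instance Definition _ := GRing.Zmodule_isLmodule.Build R (freemod R K)
  freemod_scaleA freemod_scale1 freemod_scaleDr freemod_scaleDl.

Definition basis (k : K) : freemod R K := << 1 *g k >>.

Variables (M : lmodType R) (b : K -> M).

Definition linear_ext (c : freemod R K) : M := \sum_(k <- msupp c) c@_k *: b k.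

Lemma linear_extEw (c : freemod R K) (d : {fset K}) : fsubset (msupp c) d ->
  linear_ext c = \sum_(k <- d) c@_k *: b k.
Proof.
move=> le_cd; apply: big_fset_incl => // k _ /mcoeff_outdom ->.
by rewrite scale0r.
Qed.

Fact linear_ext_is_linear : linear linear_ext.
Proof.
move=> a c1 c2.
pose d := fsetU (msupp (a *: c1 + c2)) (fsetU (msupp c1) (msupp c2)).
rewrite (@linear_extEw _ d) ?fsubsetUl //.
rewrite (@linear_extEw c1 d); last first.
  exact: fsubset_trans (fsubsetUl _ _) (fsubsetUr _ _).
rewrite (@linear_extEw c2 d); last first.
  exact: fsubset_trans (fsubsetUr _ _) (fsubsetUr _ _).
rewrite scaler_sumr -big_split /=; apply: eq_bigr => k _.
by rewrite mcoeffD freemod_scaleE scalerDl scalerA.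
Qed.

HB.instance Definition _ := GRing.isLinear.Build R (freemod R K) M _ linear_ext
  linear_ext_is_linear.

End FreeModule.

Arguments basis {R K} k.

Lemma linear_ext_basis (R : comPzRingType) (K : choiceType) (M : lmodType R)
  (b : K -> M) (k : K) : linear_ext b (basis k) = b k.
Proof.
rewrite (@linear_extEw _ _ _ _ _ [fset k]%fset) ?msuppU_le //.
by rewrite big_seq_fset1 /basis mcoeffUU scale1r.
Qed.

(* {quot I} needs a predicate canonically closed under subtraction, which
   submodClosed does not provide. *)
Definition submod_pred (R : pzRingType) (V : lmodType R) (S : submodClosed V) :
  V -> bool := fun v => v \in S.

HB.instance Definition _ (R : pzRingType) (V : lmodType R) (S : submodClosed V) :=
  GRing.isZmodClosed.Build V (submod_pred S)
    (GRing.submod_closedB (submodClosedP S)).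

Definition submod_zmod (R : pzRingType) (V : lmodType R) (S : submodClosed V) :=
  GRing.ZmodClosed.clone V (submod_pred S) _.

Definition quotmod (R : pzRingType) (V : lmodType R) (S : submodClosed V) : Type :=
  Quotient.quot (submod_zmod S).

Section QuotientModule.
Variables (R : pzRingType) (V : lmodType R) (S : submodClosed V).
Local Notation Q := (quotmod S).

HB.instance Definition _ := Choice.on Q.
HB.instance Definition _ := GRing.Zmodule.on Q.
HB.instance Definition _ := EqQuotient.on Q.

Definition quotmod_scale (a : R) (x : Q) : Q := \pi_Q (a *: repr x).

Lemma pi_quotmod_scale a (v : V) : \pi_Q (a *: v) = quotmod_scale a (\pi_Q v).
Proof.
apply/eqP; rewrite -(@Quotient.idealrBE V (submod_zmod S)) -scalerBr.
apply: (@rpredZ R V S).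
by rewrite (@Quotient.idealrBE V (submod_zmod S)) reprK.
Qed.

Lemma pi_quotmodD (u v : V) : \pi_Q (u + v) = \pi_Q u + \pi_Q v.
Proof.
have := @raddfD V _ (\pi_(Quotient.quot (submod_zmod S)) : {additive _ -> _}) u v.
exact.
Qed.

Fact quotmod_scaleA a b x :
  quotmod_scale a (quotmod_scale b x) = quotmod_scale (a * b) x.
Proof.
elim/quotW: x => v.
by rewrite -(pi_quotmod_scale b) -(pi_quotmod_scale a) -pi_quotmod_scale scalerA.
Qed.

Fact quotmod_scale1 x : quotmod_scale 1 x = x.
Proof. by elim/quotW: x => v; rewrite -pi_quotmod_scale scale1r. Qed.

Fact quotmod_scaleDr a x y :
  quotmod_scale a (x + y) = quotmod_scale a x + quotmod_scale a y.
Proof.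
elim/quotW: x => u; elim/quotW: y => v.
rewrite -pi_quotmodD -(pi_quotmod_scale a (u + v)) -(pi_quotmod_scale a u).
by rewrite -(pi_quotmod_scale a v) scalerDr pi_quotmodD.
Qed.

Fact quotmod_scaleDl x a b :
  quotmod_scale (a + b) x = quotmod_scale a x + quotmod_scale b x.
Proof.
elim/quotW: x => v.
rewrite -(pi_quotmod_scale (a + b)) -(pi_quotmod_scale a) -(pi_quotmod_scale b).
by rewrite scalerDl pi_quotmodD.
Qed.

HB.instance Definition _ := GRing.Zmodule_isLmodule.Build R Q
  quotmod_scaleA quotmod_scale1 quotmod_scaleDr quotmod_scaleDl.

End QuotientModule.

Section Homology.
Variables (R : pzRingType) (A B C : lmodType R).
Variables (f : {linear A -> B}) (g : {linear B -> C}).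

Definition in_ker : {pred B} := fun z => g z == 0.

Fact in_ker_closed : submod_closed in_ker.
Proof.
split=> [|a u v]; rewrite !unfold_in /= ?linear0 //.
by rewrite linearP => /eqP-> /eqP->; rewrite scaler0 addr0.
Qed.

HB.instance Definition _ := GRing.isSubmodClosed.Build R B in_ker in_ker_closed.

Record cycles := Cycle { cycle_val : B; cycle_valP : cycle_val \in in_ker }.

HB.instance Definition _ := [isSub for cycle_val].
HB.instance Definition _ := [Choice of cycles by <:].
HB.instance Definition _ := [SubChoice_isSubLmodule of cycles by <:].

Definition boundaries : {pred cycles} := fun z => `[< exists a, f a = val z >].

Fact boundaries_closed : submod_closed boundaries.
Proof.
split=> [|a u v]; rewrite !unfold_in.
  by apply/asboolP; exists 0; rewrite linear0.
move=> /asboolP[x fx] /asboolP[y fy]; apply/asboolP.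
by exists (a *: x + y); rewrite !linearP fx fy.
Qed.

HB.instance Definition _ :=
  GRing.isSubmodClosed.Build R cycles boundaries boundaries_closed.

Definition homology_at : lmodType R := quotmod boundaries.

End Homology.

Section QuiverHomology.
Variables (R : comPzRingType) (G : quiver).

Definition chain (n : nat) : lmodType R := freemod R (qhom (Delta n) G).

Definition face_sum (n : nat) (f : qhom (Delta n.+1) G) : chain n :=
  \sum_(i < n.+2) (-1) ^+ i *: basis (qcomp f (delta i)).

Definition diff (n : nat) : {linear chain n -> chain n.-1} :=
  match n return {linear chain n -> chain n.-1} with
  | 0 => (\0 : {linear chain 0 -> chain 0})
  | m.+1 => (linear_ext (@face_sum m) : {linear chain m.+1 -> chain m})
  end.

Definition quiver_homology (n : nat) : lmodType R :=
  homology_at (diff n.+1) (diff n).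

End QuiverHomology.

Lemma diff_diff (R : comPzRingType) (G : quiver) n (c : chain R G n.+1) :
  diff R G n (diff R G n.+1 c) = 0.
Proof.
case: n c => [|n] c //=.
rewrite {2}/linear_ext linear_sum big1 // => f _; rewrite linearZ /=.
suff -> : linear_ext (@face_sum R G n) (face_sum R f) = 0 by rewrite scaler0.
rewrite linear_sum /=.
under eq_bigr => i _ do rewrite linearZ /= linear_ext_basis scaler_sumr.
pose T (p : 'I_n.+3 * 'I_n.+2) : chain R G n := (-1) ^+ p.1 *:
  ((-1) ^+ p.2 *: basis (qcomp (qcomp f (delta p.1)) (delta p.2))).
rewrite (pair_big xpredT xpredT (fun i j => T (i, j))) /=.
rewrite (bigID (fun p : 'I_n.+3 * 'I_n.+2 => p.2 < p.1)%N) /=.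
pose h (p : 'I_n.+3 * 'I_n.+2) : 'I_n.+3 * 'I_n.+2 :=
  if (p.2 < p.1)%N then (inord p.2, inord p.1.-1) else (inord p.2.+1, inord p.1).
rewrite [X in _ + X](reindex_onto h h) /=; last first.
  case=> i j /= nlt; rewrite /h /= (negbTE nlt) /=.
  have ij : (i < n.+2)%N by have := ltn_ord j; move: nlt; lia.
  rewrite !inordK //; last by rewrite ltnS.
  rewrite ltnS leqNgt nlt /=.
  by congr pair; apply/val_inj; rewrite /= inordK.
rewrite [X in _ + X](eq_bigl (fun p : 'I_n.+3 * 'I_n.+2 => p.2 < p.1)%N); last first.
  case=> i j; rewrite /h /=; case: ifP => lt /=.
    have hi := ltn_ord i; have hj := ltn_ord j.
    rewrite !inordK /=; try lia.
    have -> : (i.-1 < j)%N = false by lia.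
    rewrite /= xpair_eqE; apply/andP; split; apply/eqP/val_inj => /=;
      rewrite inordK; lia.
  have hi := ltn_ord i; have hj := ltn_ord j.
  rewrite !inordK /=; try lia.
rewrite -big_split big1 //= => -[i j] /= lt.
rewrite /h /= lt /T /=.
have hi := ltn_ord i; have hj := ltn_ord j.
have E : qcomp (qcomp f (delta i)) (delta j) =
  qcomp (qcomp f (delta (inord j))) (delta (inord i.-1)).
  have := @delta_delta n i (inord j) (inord i.-1) j.
  rewrite !inordK; try lia.
  move=> /(_ lt erefl erefl) E.
  apply: qhom_ext => x /=.
    by have /(congr1 (@vmap _ _)) /(congr1 (fun g => g x)) /= -> := E.
  by have /(congr1 (@emap _ _)) /(congr1 (fun g => g x)) /= -> := E.
rewrite E !inordK; try lia.
rewrite !scalerA -scalerDl -!exprD.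
have -> : (i + j = (j + i.-1).+1)%N by lia.
by rewrite exprS mulN1r addNr scale0r.
Qed.

Section StrongCylinder.
Variables (G : quiver) (G' : subquiver G).

(* [inl v] is (v,0) and [inr v] is (v,1). *)
Definition cyl_vertex : Type := (vertex G + {v | sub_vertex G' v})%type.

Definition mixed_edge (e : edge G) : Prop :=
  (sub_vertex G' (src e) /\ ~ sub_vertex G' (tgt e)) \/
  (~ sub_vertex G' (src e) /\ sub_vertex G' (tgt e)).

Inductive cyl_edge : Type :=
  | Cyl_edge0 (e : edge G)                           (* (e,0) *)
  | Cyl_edge1 (e : edge G) of sub_edge G' e          (* (e,1) *)
  | Cyl_vertex01 (v : vertex G) of sub_vertex G' v   (* (v,0->1) *)
  | Cyl_edge01 (e : edge G) of sub_edge G' e         (* (e,0->1) *)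
  | Cyl_mixed (e : edge G) of mixed_edge e.          (* e_{e} *)

Definition cyl_top (v : vertex G) : cyl_vertex :=
  match pselect (sub_vertex G' v) with
  | left hv => inr (exist _ v hv)
  | right _ => inl v
  end.

Definition cyl_src (e : cyl_edge) : cyl_vertex :=
  match e with
  | Cyl_edge0 e => inl (src e)
  | Cyl_edge1 e he => inr (exist _ (src e) (sub_src he))
  | Cyl_vertex01 v _ => inl v
  | Cyl_edge01 e _ => inl (src e)
  | Cyl_mixed e _ => cyl_top (src e)
  end.

Definition cyl_tgt (e : cyl_edge) : cyl_vertex :=
  match e with
  | Cyl_edge0 e => inl (tgt e)
  | Cyl_edge1 e he => inr (exist _ (tgt e) (sub_tgt he))
  | Cyl_vertex01 v hv => inr (exist _ v hv)
  | Cyl_edge01 e he => inr (exist _ (tgt e) (sub_tgt he))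
  | Cyl_mixed e _ => cyl_top (tgt e)
  end.

Definition strong_cylinder : quiver :=
  @Quiver cyl_vertex cyl_edge cyl_src cyl_tgt
    (let: inhabits v := vertex_inhabited G in inhabits (inl v)).

Definition cyl_i0 : qhom G strong_cylinder :=
  @QHom G strong_cylinder inl Cyl_edge0 (fun _ => erefl) (fun _ => erefl).

Hypothesis fullG' : full_subquiver G'.

Lemma mixed_edgeP (e : edge G) : ~ sub_edge G' e ->
  ~ (~ sub_vertex G' (src e) /\ ~ sub_vertex G' (tgt e)) -> mixed_edge e.
Proof.
have := fullG' e; rewrite /mixed_edge.
by case: (pselect (sub_vertex G' (src e))); case: (pselect (sub_vertex G' (tgt e)));
  tauto.
Qed.

Definition cyl_i1_edge (e : edge G) : cyl_edge :=
  match pselect (sub_edge G' e) with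
  | left he => Cyl_edge1 he
  | right he =>
      match pselect (~ sub_vertex G' (src e) /\ ~ sub_vertex G' (tgt e)) with
      | left _ => Cyl_edge0 e
      | right hv => Cyl_mixed (mixed_edgeP he hv)
      end
  end.

Lemma cyl_top_in (v : vertex G) (hv : sub_vertex G' v) :
  cyl_top v = inr (exist _ v hv).
Proof.
by rewrite /cyl_top; case: pselect => // h; rewrite (Prop_irrelevance h hv).
Qed.

Lemma cyl_top_out (v : vertex G) : ~ sub_vertex G' v -> cyl_top v = inl v.
Proof. by rewrite /cyl_top; case: pselect. Qed.

Lemma cyl_i1_src (e : edge G) : cyl_src (cyl_i1_edge e) = cyl_top (src e).
Proof.
rewrite /cyl_i1_edge; case: pselect => [he|nhe] /=; first by rewrite -cyl_top_in.
by case: pselect => [[hs _]|nh] //=; rewrite cyl_top_out.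
Qed.

Lemma cyl_i1_tgt (e : edge G) : cyl_tgt (cyl_i1_edge e) = cyl_top (tgt e).
Proof.
rewrite /cyl_i1_edge; case: pselect => [he|nhe] /=; first by rewrite -cyl_top_in.
by case: pselect => [[_ ht]|nh] //=; rewrite cyl_top_out.
Qed.

Definition cyl_i1 : qhom G strong_cylinder :=
  @QHom G strong_cylinder cyl_top cyl_i1_edge cyl_i1_src cyl_i1_tgt.

End StrongCylinder.

Definition lSh_homotopic1 (G H : quiver) (f0 f1 : qhom G H) : Prop :=
  exists (G' : subquiver G) (fullG' : full_subquiver G')
    (F : qhom (strong_cylinder G') H),
    qcomp F (cyl_i0 G') = f0 /\ qcomp F (cyl_i1 fullG') = f1.

Section Loops.
Variable G : quiver.

Definition loop_at (v : vertex G) (l : edge G) : Prop := src l = v /\ tgt l = v.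

Definition has_loop (v : vertex G) : Prop := exists l, loop_at v l.

Definition multiple_edge (e : edge G) : Prop :=
  exists e', [/\ e' <> e, src e' = src e & tgt e' = tgt e].

Definition double_edge (e : edge G) : Prop :=
  src e <> tgt e /\ exists e', src e' = tgt e /\ tgt e' = src e.

Definition degenerate_loop (l : edge G) : Prop :=
  exists v, [/\ loop_at v l,
    forall l', loop_at v l' -> l' = l &
    forall u e, u <> v ->
      (src e = u /\ tgt e = v) \/ (src e = v /\ tgt e = u) ->
      ~ multiple_edge e /\ (has_loop u \/ ~ double_edge e)].

End Loops.

Definition wide_subquiver (G : quiver) (E : edge G -> Prop) : subquiver G :=
  @Subquiver G (fun _ => True) E (fun _ _ => I) (fun _ _ => I)
    (let: inhabits v := vertex_inhabited G in ex_intro _ v I).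

Definition remove_edges (G : quiver) (L : edge G -> Prop) : quiver :=
  quiver_of (wide_subquiver (fun e => ~ L e)).

(* "Removing one or more degenerate loops" is read as removing a set L of loops
   one after another, each being degenerate at the moment it is removed.  This
   is possible if and only if every l in L is degenerate both in G2 and in the
   quiver where all the other loops of L are already removed, and then any order
   will do.  Degeneracy in G2 alone is not enough: if two vertices are joined by
   an edge in each direction and each carries a loop, both loops are degenerate,
   but without them the homology changes in degree 1 (over a nonzero ring).
   Being a subquiver is understood up to isomorphism. *)
Definition loop_contraction (G1 G2 : quiver) : Prop :=
  exists L : edge G2 -> Prop,
    [/\ exists l, L l,
        forall l, L l -> degenerate_loop l,
        forall l, L l ->
          exists2 l' : edge (remove_edges (fun e => L e /\ e <> l)),
            sval l' = l & degenerate_loop l' &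
        qiso G1 (remove_edges L)].

Definition lSh_equivalent1 (G1 G2 : quiver) : Prop :=
  exists (f : qhom G1 G2) (g : qhom G2 G1),
    lSh_homotopic1 (qcomp g f) (qid G1) /\ lSh_homotopic1 (qcomp f g) (qid G2).

Definition wlSh_equivalent1 (G1 G2 : quiver) : Prop :=
  [\/ lSh_equivalent1 G1 G2, loop_contraction G1 G2 | loop_contraction G2 G1].

Definition wlSh_equivalent : quiver -> quiver -> Prop :=
  clos_refl_sym_trans quiver wlSh_equivalent1.

(* Main.v *)
(* A strong homotopy moves some vertices along edges and fixes the others. The
   usual prism operator still works, because the prism over a simplex at a fixed
   vertex is simply omitted: the two faces of it that would telescope coincide.

   For a loop contraction, a chain with boundary in the smaller quiver is pushed
   into the smaller quiver by adding boundaries. Only finitely many of the loops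
   occur in it, and they are treated one at a time. Let v carry such a loop, let
   [p] and [z] be the first and the last position of v in a simplex, [p < z], and
   let w be the first vertex other than v between them (w = v if there is none).
   Edges v -> w and w -> v exist, so w carries a loop that is not removed, and w
   can be inserted again in front of position [p], edges at v being unique.
   Adding the boundary of the resulting simplex replaces the given one by
   simplices with smaller [z - p]; when w = v, it is cancelled altogether. *)

From HB Require Import structures.
Require Import Defs.
From mathcomp Require Import all_boot all_algebra generic_quotient ring_quotient.
From mathcomp Require Import finmap boolp zify.
From mathcomp.multinomials Require Import monalg.

Set Implicit Arguments.
Unset Strict Implicit.
Unset Printing Implicit Defensive.

Import GRing.Theory.
Local Open Scope ring_scope.
Local Open Scope quotient_scope.

(** * Homology of linear maps *)

Lemma inj_surj_bij (A B : Type) (f : A -> B) :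
  injective f -> (forall y, exists x, f x = y) -> bijective f.
Proof.
move=> f_inj f_surj; pose g y := projT1 (cid (f_surj y)).
have gK y : f (g y) = y by rewrite /g; case: cid.
by exists g => // x; apply: f_inj.
Qed.

Lemma linear_bij_inv (R : pzRingType) (U V : lmodType R) (f : {linear U -> V}) :
  bijective f -> exists g : {linear V -> U}, bijective g.
Proof.
move=> [g fK gK].
have g_lin : linear g by move=> a x y; apply: (can_inj fK); rewrite linearP !gK.
pose gL := GRing.isLinear.Build R V U *:%R g g_lin.
pose h : {linear V -> U} := HB.pack g gL.
by exists h, f.
Qed.

Lemma homology_classP (R : pzRingType) (A B C : lmodType R)
  (f : {linear A -> B}) (g : {linear B -> C}) (x y : cycles g) :
  reflect (exists a, f a = val x - val y)
          (\pi_(homology_at f g) x == \pi_(homology_at f g) y).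
Proof.
have := @Quotient.idealrBE _ (submod_zmod (@boundaries R A B C f g)) x y.
move=> <-; rewrite unfold_in /submod_pred unfold_in.
by apply: (iffP (asboolP _)) => -[a fa]; exists a; rewrite fa ?raddfB.
Qed.

Lemma homology_class_linear (R : pzRingType) (A B C : lmodType R)
  (f : {linear A -> B}) (g : {linear B -> C}) a (x y : cycles g) :
  \pi_(homology_at f g) (a *: x + y) =
  a *: \pi_(homology_at f g) x + \pi_(homology_at f g) y.
Proof.
by rewrite (@pi_quotmodD R _ (@boundaries R A B C f g)) pi_quotmod_scale.
Qed.

Section HomologyMap.
Variables (R : pzRingType) (A B C A' B' C' : lmodType R).
Variables (f : {linear A -> B}) (g : {linear B -> C}).
Variables (f' : {linear A' -> B'}) (g' : {linear B' -> C'}).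

Variable phi : {linear B -> B'}.
Hypothesis phi_cycle : forall z, g z = 0 -> g' (phi z) = 0.
Hypothesis phi_boundary : forall a, exists a', f' a' = phi (f a).

Fact cycle_map_subproof (z : cycles g) : phi (val z) \in in_ker g'.
Proof.
case: z => z zP /=; rewrite unfold_in /=; apply/eqP/phi_cycle.
by apply/eqP; move: zP; rewrite unfold_in.
Qed.

Definition cycle_map (z : cycles g) : cycles g' := Cycle (cycle_map_subproof z).

Definition homology_map (x : homology_at f g) : homology_at f' g' :=
  \pi_(homology_at f' g') (cycle_map (repr x)).

Lemma homology_map_pi (z : cycles g) :
  homology_map (\pi_(homology_at f g) z) = \pi_(homology_at f' g') (cycle_map z).
Proof.
apply/eqP/homology_classP => /=.
have /eqP/homology_classP[a fa] : \pi_(homology_at f g) (repr (\pi_(homology_at f g) z)) =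
  \pi_(homology_at f g) z by rewrite reprK.
by have [a' fa'] := phi_boundary a; exists a'; rewrite fa' fa raddfB.
Qed.

Fact homology_map_is_linear : linear homology_map.
Proof.
move=> a x y; elim/quotW: x => x; elim/quotW: y => y.
rewrite -homology_class_linear !homology_map_pi -homology_class_linear.
by congr (\pi_ _ _); apply/val_inj; rewrite /= linearP.
Qed.

(** The two premises are injectivity and surjectivity of [homology_map], tested on representing
    cycles. Everything takes place in one degree, so [phi_cycle] and [phi_boundary] stand in for a
    full chain map. *)
Lemma homology_iso :
  (forall z, g z = 0 -> forall a', f' a' = phi z -> exists a, f a = z) ->
  (forall z', g' z' = 0 -> exists z a', g z = 0 /\ f' a' = z' - phi z) ->
  exists h : {linear homology_at f g -> homology_at f' g'}, bijective h.
Proof.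
move=> phi_inj phi_surj.
pose hL := GRing.isLinear.Build R (homology_at f g) (homology_at f' g') *:%R
  homology_map homology_map_is_linear.
pose h : {linear homology_at f g -> homology_at f' g'} := HB.pack homology_map hL.
exists h; apply: inj_surj_bij => [x y|y]; rewrite /h /=.
  elim/quotW: x => x; elim/quotW: y => y.
  rewrite !homology_map_pi => /eqP/homology_classP[a' fa'].
  apply/eqP/homology_classP; apply: (phi_inj _ _ a').
    by have := cycle_valP (x - y); rewrite unfold_in => /eqP; rewrite raddfB.
  by rewrite fa' raddfB.
elim/quotW: y => z'; have /eqP gz' : g' (val z') == 0.
  by have := cycle_valP z'; rewrite unfold_in.
have [z [a' [gz fa']]] := phi_surj _ gz'.
have zP : z \in in_ker g by rewrite unfold_in /= gz.
(* The witness is [- a'] because the classes are compared in the order opposite to [fa']. *)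
exists (\pi_(homology_at f g) (Cycle zP)); rewrite homology_map_pi.
apply/eqP/homology_classP; exists (- a').
by rewrite linearN [f' a']fa' opprB.
Qed.

End HomologyMap.

(** * Simplices indexed by natural numbers *)

Section Support.
Variables (R : comPzRingType) (K : choiceType).
Implicit Types (P Q : K -> Prop) (c : freemod R K).

Definition supported P c : Prop := forall k, c@_k != 0 -> P k.

Lemma supportedD P c1 c2 : supported P c1 -> supported P c2 -> supported P (c1 + c2).
Proof.
move=> s1 s2 k; rewrite mcoeffD; have [e1|n1 _] := eqVneq c1@_k 0; last exact: s1.
by rewrite e1 add0r; apply: s2.
Qed.

Lemma supportedZ P a c : supported P c -> supported P (a *: c).
Proof.
move=> s k; rewrite freemod_scaleE => n; apply: s.
by apply: contraNneq n => ->; rewrite mulr0.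
Qed.

Lemma supported0 P : supported P (0 : freemod R K).
Proof. by move=> k; rewrite mcoeff0 eqxx. Qed.

Lemma supportedN P c : supported P c -> supported P (- c).
Proof. by move=> s; rewrite -scaleN1r; apply: supportedZ. Qed.

Lemma supported_sum P (I : Type) (r : seq I) (p : pred I) (F : I -> freemod R K) :
  (forall i, p i -> supported P (F i)) -> supported P (\sum_(i <- r | p i) F i).
Proof. by move=> s; elim/big_ind: _ => //; [exact: supported0|exact: supportedD]. Qed.

Lemma supported_basis P k : P k -> supported P (basis k : freemod R K).
Proof. by move=> Pk l; rewrite /basis mcoeffU; have [<-|_] := eqVneq k l; rewrite /= ?eqxx. Qed.

Lemma supported_sub P Q c : (forall k, P k -> Q k) -> supported P c -> supported Q c.
Proof. by move=> PQ s k /s/PQ. Qed.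

Lemma freemod_basisE c : c = \sum_(k <- msupp c) c@_k *: basis k.
Proof.
rewrite {1}[c]monalgE; apply: eq_bigr => k _.
apply/malgP => l; rewrite freemod_scaleE !mcoeffU.
by rewrite mulrnAr mulr1.
Qed.

Lemma linear_on_supported P c (M : lmodType R) (f g : {linear freemod R K -> M}) :
  supported P c -> (forall k, P k -> f (basis k) = g (basis k)) -> f c = g c.
Proof.
move=> s fg; rewrite (freemod_basisE c) !linear_sum /= !big_seq.
apply: eq_bigr => k; rewrite -mcoeff_neq0 => /s Pk.
by rewrite !linearZ /= fg.
Qed.

Lemma eq_linear_basis (M : lmodType R) (f g : {linear freemod R K -> M}) :
  (forall k, f (basis k) = g (basis k)) -> forall c, f c = g c.
Proof. by move=> fg c; apply: (@linear_on_supported (fun=> True)) => // k _. Qed.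

End Support.

Lemma supported_linear (R : comPzRingType) (K K' : choiceType) (P : K -> Prop)
  (Q : K' -> Prop) (f : {linear freemod R K -> freemod R K'}) c :
  supported P c -> (forall k, P k -> supported Q (f (basis k))) -> supported Q (f c).
Proof.
move=> s fs; rewrite [in f c](freemod_basisE c) linear_sum /= [X in supported Q X]big_seq.
apply: supported_sum => k.
by rewrite -mcoeff_neq0 => /s Pk; rewrite linearZ; apply: supportedZ; apply: fs.
Qed.

(* A candidate [n]-simplex indexed by all natural numbers: only the values at
   indices [a < b <= n] matter, and an edge may be missing. *)
Record presimplex (G : quiver) := Presimplex {
  pvert : nat -> vertex G;
  pedge : nat -> nat -> option (edge G) }.

Section Cells.
Variables (R : comPzRingType) (G : quiver).
Implicit Types (n : nat) (D E : presimplex G).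

Definition simplicial n D : Prop := forall a b, (a < b <= n)%N ->
  exists x, [/\ pedge D a b = Some x, src x = pvert D a & tgt x = pvert D b].

Definition eqs n D E : Prop :=
  (forall a, (a <= n)%N -> pvert D a = pvert E a) /\
  (forall a b, (a < b <= n)%N -> pedge D a b = pedge E a b).

Definition realizes n D (f : qhom (Delta n) G) : Prop :=
  (forall i : 'I_n.+1, vmap f i = pvert D i) /\
  (forall e : edge (Delta n), Some (emap f e) = pedge D (val e).1 (val e).2).

(** The default 0 is put to use later: a prism over an unmoved vertex lacks its vertical edge, so
    its cell drops out of the prism operator by itself. *)
Definition cell n D : chain R G n :=
  match pselect (exists f, @realizes n D f) with
  | left h => basis (projT1 (cid h))
  | right _ => 0
  end.

Definition pface (j : nat) D : presimplex G :=
  Presimplex (pvert D \o bump j) (fun a b => pedge D (bump j a) (bump j b)).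

(** Indices above n are sent to 0 by [inord], so the values there are arbitrary and comparisons are
    made by [eqs n]. *)
Definition presimplex_of n (f : qhom (Delta n) G) : presimplex G :=
  Presimplex (fun a => vmap f (inord a))
    (fun a b => omap (emap f) (insub (inord a, inord b))).

Lemma eqs_sym n D E : eqs n D E -> eqs n E D.
Proof. by case=> v e; split=> *; rewrite ?v ?e. Qed.

Lemma realizes_inj n D f g : @realizes n D f -> realizes D g -> f = g.
Proof.
move=> [fv fe] [gv ge]; apply: qhom_ext => [i|e]; first by rewrite fv gv.
by apply: Some_inj; rewrite fe ge.
Qed.

Lemma eqs_realizes n D E f : eqs n D E -> @realizes n D f -> realizes E f.
Proof.
move=> [v e] [fv fe]; split=> [i|x]; first by rewrite fv v //; have := ltn_ord i; lia.
by rewrite fe e // (valP x) /= -ltnS.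
Qed.

Lemma cell_realizes n D f : @realizes n D f -> cell n D = basis f.
Proof.
rewrite /cell => Df; case: pselect => [h|[]]; last by exists f.
by congr basis; case: cid => g /= Dg; apply: realizes_inj Dg Df.
Qed.

Lemma simplicialP n D : simplicial n D <-> exists f, @realizes n D f.
Proof.
split=> [s|[f [fv fe]] a b ab]; last first.
  have an : (a < n.+1)%N by lia.
  have bn : (b < n.+1)%N by lia.
  have lt : (Ordinal an < Ordinal bn)%N by rewrite /=; lia.
  pose x : edge (Delta n) := exist (fun p : 'I_n.+1 * 'I_n.+1 => (p.1 < p.2)%N) 
    (Ordinal an, Ordinal bn) lt.
  exists (emap f x); rewrite -[pedge D a b](fe x); split=> //.
    by rewrite src_emap fv.
  by rewrite tgt_emap fv.
have ex (e : edge (Delta n)) : exists x, [/\ pedge D (val e).1 (val e).2 = Some x,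
    src x = pvert D (val e).1 & tgt x = pvert D (val e).2].
  by apply: s; have := valP e; have := ltn_ord (val e).2; lia.
pose v (i : vertex (Delta n)) := pvert D i.
pose em e := projT1 (cid (ex e)).
have ems e : src (em e) = v (src e) by rewrite /em; case: cid => x [].
have emt e : tgt (em e) = v (tgt e) by rewrite /em; case: cid => x [].
exists (QHom ems emt); split=> // e /=.
by rewrite /em; case: cid => x [].
Qed.

Lemma cell_eqs n D E : eqs n D E -> cell n D = cell n E.
Proof.
move=> DE; have [[f Df]|nD] := pselect (exists f, @realizes n D f).
  by rewrite (cell_realizes Df) (cell_realizes (eqs_realizes DE Df)).
rewrite /cell; case: pselect => // _; case: pselect => // -[f Ef].
by case: nD; exists f; apply: eqs_realizes Ef; apply: eqs_sym.
Qed.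

Lemma cell_nonsimplicial n D : ~ simplicial n D -> cell n D = 0.
Proof. by rewrite simplicialP /cell; case: pselect. Qed.

Lemma supported_cell n D (P : qhom (Delta n) G -> Prop) :
  (forall f, realizes D f -> P f) -> supported P (cell n D).
Proof.
move=> DP; have [/simplicialP[f Df]|/cell_nonsimplicial->] := pselect (simplicial n D).
  by rewrite (cell_realizes Df); apply: supported_basis; apply: DP.
exact: supported0.
Qed.

Lemma presimplex_ofP n (f : qhom (Delta n) G) : realizes (presimplex_of f) f.
Proof.
split=> [i|e] /=; first by rewrite inord_val.
by rewrite !inord_val -surjective_pairing valK.
Qed.

Lemma simplicial_presimplex_of n (f : qhom (Delta n) G) : simplicial n (presimplex_of f).
Proof. by apply/simplicialP; exists f; apply: presimplex_ofP. Qed.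

Lemma cell_presimplex_of n (f : qhom (Delta n) G) : cell n (presimplex_of f) = basis f.
Proof. exact: cell_realizes (presimplex_ofP f). Qed.

Lemma realizes_eqs n D f : @realizes n D f -> eqs n (presimplex_of f) D.
Proof.
move=> [fv fe]; split=> [a an|a b ab] /=; first by rewrite fv inordK.
case: insubP => [e _ ee|] /=; last by rewrite /= !inordK; lia.
by rewrite fe ee /= !inordK //; lia.
Qed.

Lemma realizes_face n D f (i : 'I_n.+2) :
  @realizes n.+1 D f -> realizes (pface i D) (qcomp f (delta i)).
Proof. by move=> [fv fe]; split=> [j|e] /=; [rewrite fv|rewrite fe]. Qed.

Lemma simplicial_pface n D j : (j <= n.+1)%N -> simplicial n.+1 D -> simplicial n (pface j D).
Proof.
move=> jn /simplicialP[f Df]; apply/simplicialP.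
by exists (qcomp f (delta (Ordinal (jn : (j < n.+2)%N)))); apply: (realizes_face _ Df).
Qed.

Lemma diff_cell n D : simplicial n.+1 D ->
  diff R G n.+1 (cell n.+1 D) = \sum_(0 <= j < n.+2) (-1) ^+ j *: cell n (pface j D).
Proof.
move=> /simplicialP[f Df]; rewrite (cell_realizes Df) /= linear_ext_basis big_mkord.
by apply: eq_bigr => i _; rewrite (cell_realizes (realizes_face i Df)).
Qed.

Lemma diff_basis n (f : qhom (Delta n.+1) G) :
  diff R G n.+1 (basis f) =
  \sum_(0 <= j < n.+2) (-1) ^+ j *: cell n (pface j (presimplex_of f)).
Proof. by rewrite -cell_presimplex_of diff_cell //; apply: simplicial_presimplex_of. Qed.

(** This evaluates an operator, defined on basis elements through [presimplex_of], at a simplex that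
    is only given as a presimplex, such as a face. *)
Lemma linear_ext_cell (M : lmodType R) n D (h : presimplex G -> M) :
  simplicial n D -> (forall E E', eqs n E E' -> h E = h E') ->
  linear_ext (fun f : qhom (Delta n) G => h (presimplex_of f)) (cell n D) = h D.
Proof.
move=> /simplicialP[f Df] hE; rewrite (cell_realizes Df) linear_ext_basis.
exact/hE/realizes_eqs.
Qed.

End Cells.

(** * Chain maps *)

Lemma qcompA (G H K L : quiver) (h : qhom K L) (g : qhom H K) (f : qhom G H) :
  qcomp h (qcomp g f) = qcomp (qcomp h g) f.
Proof. by apply: qhom_ext. Qed.

Lemma qcomp1q (G H : quiver) (f : qhom G H) : qcomp (qid H) f = f.
Proof. by apply: qhom_ext. Qed.

Definition chain_map (R : comPzRingType) (G H : quiver) (f : qhom G H) (n : nat) :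
    {linear chain R G n -> chain R H n} :=
  linear_ext (fun k => basis (qcomp f k)).

Section ChainMap.
Variables (R : comPzRingType).

Lemma chain_map_basis (G H : quiver) (f : qhom G H) n k :
  chain_map R f n (basis k) = basis (qcomp f k).
Proof. exact: linear_ext_basis. Qed.

Lemma chain_map_comp (G H K : quiver) (g : qhom H K) (f : qhom G H) n c :
  chain_map R (qcomp g f) n c = chain_map R g n (chain_map R f n c).
Proof.
apply: (@eq_linear_basis R _ _ _ (chain_map R g n \o chain_map R f n)%FUN) => k.
by rewrite /= !linear_ext_basis qcompA.
Qed.

Lemma chain_map_id (G : quiver) n c : chain_map R (qid G) n c = c.
Proof.
apply: (@eq_linear_basis R _ _ _ idfun) => k.
by rewrite chain_map_basis qcomp1q.
Qed.

Lemma chain_map_diff (G H : quiver) (f : qhom G H) n c :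
  diff R H n (chain_map R f n c) = chain_map R f n.-1 (diff R G n c).
Proof.
case: n c => [|n] c; first by rewrite /= linear0.
apply: (@eq_linear_basis R _ _ (diff R H n.+1 \o chain_map R f n.+1)%FUN
  (chain_map R f n \o diff R G n.+1)%FUN) => k.
rewrite /= !linear_ext_basis linear_sum; apply: eq_bigr => i _.
by rewrite linearZ /= linear_ext_basis qcompA.
Qed.

Definition homology_isomorphic (G H : quiver) : Prop := forall n,
  exists h : {linear quiver_homology R G n -> quiver_homology R H n}, bijective h.

Lemma homology_isomorphic_sym (G H : quiver) :
  homology_isomorphic G H -> homology_isomorphic H G.
Proof. by move=> GH n; have [h /linear_bij_inv] := GH n. Qed.

Lemma homology_isomorphic_trans (G H K : quiver) :
  homology_isomorphic G H -> homology_isomorphic H K -> homology_isomorphic G K.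
Proof.
move=> GH HK n; have [h h_bij] := GH n; have [k k_bij] := HK n.
by exists (k \o h)%FUN; apply: bij_comp.
Qed.

Lemma qhom_homology_isomorphic (G H : quiver) (f : qhom G H) :
  (forall n z, diff R G n z = 0 ->
    forall a', diff R H n.+1 a' = chain_map R f n z -> exists a, diff R G n.+1 a = z) ->
  (forall n z', diff R H n z' = 0 ->
    exists z a', diff R G n z = 0 /\ diff R H n.+1 a' = z' - chain_map R f n z) ->
  homology_isomorphic G H.
Proof.
move=> f_inj f_surj n.
apply: (@homology_iso R _ _ _ _ _ _ (diff R G n.+1) (diff R G n) (diff R H n.+1)
  (diff R H n) (chain_map R f n)) => [z dz|a||].
- by rewrite chain_map_diff dz linear0.
- by exists (chain_map R f n.+1 a); rewrite chain_map_diff.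
- exact: f_inj.
- exact: f_surj.
Qed.

Lemma homology_equivalence (G H : quiver) (f : qhom G H) (g : qhom H G) :
  (forall n z, diff R G n z = 0 ->
    exists a, diff R G n.+1 a = z - chain_map R (qcomp g f) n z) ->
  (forall n z, diff R H n z = 0 ->
    exists a, diff R H n.+1 a = z - chain_map R (qcomp f g) n z) ->
  homology_isomorphic G H.
Proof.
move=> gf fg; apply: (qhom_homology_isomorphic (f := f)) => n z dz.
  (* If [a'] bounds the image of z under f, its image under g bounds that of z under [qcomp g f];
     the chain [a] bounds the difference to z. *)
  move=> a' fa'; have [a fa] := gf n z dz; exists (a + chain_map R g n.+1 a').
  by rewrite linearD fa chain_map_diff [diff _ _ _ a']fa' chain_map_comp subrK.
have [a fa] := fg n z dz; exists (chain_map R g n z), a.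
by rewrite fa chain_map_diff dz linear0 chain_map_comp.
Qed.

Lemma qiso_homology_isomorphic (G H : quiver) : qiso G H -> homology_isomorphic G H.
Proof.
move=> [f [g [gf fg]]]; apply: (@homology_equivalence _ _ f g) => n z _; exists 0.
  by rewrite gf chain_map_id linear0 subrr.
by rewrite fg chain_map_id linear0 subrr.
Qed.

End ChainMap.

(** * The prism operator *)

Ltac index_cases :=
  rewrite /= /bump; repeat (case: ifP => ?); try lia;
  try (congr (vmap _ (pvert _ _)); lia);
  try (congr (omap _ (pedge _ _ _)); lia);
  try (f_equal; congr (pvert _ _); lia).

(** After the shift of i by one, the first inner sums run over j <= i and the second ones over j >
    i. Together they fill the rectangle i < n, j <= n. *)
Lemma sum_around_diagonal (V : zmodType) n (K : nat -> nat -> V) :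
  \sum_(0 <= i < n.+1) (- \sum_(0 <= j < i) K i.-1 j - \sum_(i.+1 <= j < n.+1) K i j) =
  - \sum_(0 <= j < n.+1) \sum_(0 <= i < n) K i j.
Proof.
rewrite sumrB big_nat_recl //= big_geq // oppr0 add0r.
rewrite [X in _ - X]big_nat_recr //= [X in _ - (_ + X)]big_geq // addr0.
rewrite -sumrB exchange_big_nat -sumrN /=; apply: eq_big_nat => i le_in.
by rewrite [in RHS](big_cat_nat (n := i.+1)) //= ?opprD //; lia.
Qed.

Section Prism.
Variables (R : comPzRingType) (G H : quiver) (f0 f1 : qhom G H).
(* [ve v] is the edge from [f0 v] to [f1 v]; [None] stands for a vertex that the
   homotopy does not move. [de e] goes from [f0 (src e)] to [f1 (tgt e)]. *)
Variables (de : edge G -> edge H) (ve : vertex G -> option (edge H)).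
Hypothesis src_de : forall e, src (de e) = vmap f0 (src e).
Hypothesis tgt_de : forall e, tgt (de e) = vmap f1 (tgt e).
Hypothesis ve_some : forall v x, ve v = Some x -> src x = vmap f0 v /\ tgt x = vmap f1 v.
Hypothesis ve_none : forall v, ve v = None -> vmap f0 v = vmap f1 v.
Hypothesis de_tgt_none : forall e, ve (tgt e) = None -> de e = emap f0 e.
Hypothesis de_src_none : forall e, ve (src e) = None -> de e = emap f1 e.
Implicit Types (i j n : nat) (D E : presimplex G).

(** These simplices interpolate between the image of D under [f1], for i = 0, and that under [f0],
    for i = n + 1. They are the walls between neighbouring prisms. *)
Definition step i D : presimplex H := Presimplex
  (fun a => if (a < i)%N then vmap f0 (pvert D a) else vmap f1 (pvert D a))
  (fun a b => if (b < i)%N then omap (emap f0) (pedge D a b)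
              else if (i <= a)%N then omap (emap f1) (pedge D a b)
              else omap de (pedge D a b)).

(** The i-th simplex in the usual triangulation of the prism over D: the vertex at i occurs twice,
    first under [f0] and then under [f1], joined by the vertical edge [ve]. *)
Definition prism i D : presimplex H := Presimplex
  (fun a => if (a <= i)%N then vmap f0 (pvert D a) else vmap f1 (pvert D a.-1))
  (fun a b => if (b <= i)%N then omap (emap f0) (pedge D a b)
              else if (i < a)%N then omap (emap f1) (pedge D a.-1 b.-1)
              else if (a == i) && (b == i.+1) then ve (pvert D i)
              else omap de (pedge D a b.-1)).

Lemma eqs_prism n i D E : (i <= n)%N -> eqs n D E -> eqs n.+1 (prism i D) (prism i E).
Proof.
move=> le_in [v e]; split=> [a an|a b ab] /=.
  by case: ifP => ?; rewrite v //; lia.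
by repeat (case: ifP => ?); rewrite ?e ?v //; lia.
Qed.

(** This and the next three lemmas are the identities of a simplicial homotopy: a face away from the
    vertical edge is a prism over a face of D, and the two faces that delete one of its ends are
    walls. *)
Lemma pface_prism_le n i j D : (j <= i)%N ->
  eqs n (pface j (prism i.+1 D)) (prism i (pface j D)).
Proof.
by move=> ji; split=> [a an|a b ab]; index_cases.
Qed.

Lemma pface_prism_gt n i j D : (i < j)%N ->
  eqs n (pface j.+1 (prism i D)) (prism i (pface j D)).
Proof.
by move=> ji; split=> [a an|a b ab]; index_cases.
Qed.

Lemma pface_prism_eq n i D : eqs n (pface i (prism i D)) (step i D).
Proof.
by split=> [a an|a b ab]; index_cases.
Qed.

Lemma pface_prism_succ n i D : eqs n (pface i.+1 (prism i D)) (step i.+1 D).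
Proof.
by split=> [a an|a b ab]; index_cases.
Qed.

Lemma prism_simplicial n i D x : simplicial n D -> (i <= n)%N ->
  ve (pvert D i) = Some x -> simplicial n.+1 (prism i D).
Proof.
move=> s le_in vx a b ab; rewrite /=.
have [bi|ib] := leqP b i.
  have [y [-> sy ty]] := s a b ltac:(lia).
  have -> : (a <= i)%N by lia.
  by exists (emap f0 y); rewrite src_emap tgt_emap sy ty.
have [ia|ai] := ltnP i a.
  have [y [-> sy ty]] := s a.-1 b.-1 ltac:(lia).
  by exists (emap f1 y); rewrite src_emap tgt_emap sy ty.
case: ifP => [/andP[/eqP-> /eqP->]|ne].
  by exists x; rewrite vx; have [-> ->] := ve_some vx.
have [y [-> sy ty]] := s a b.-1 ltac:(lia).
by exists (de y); rewrite src_de tgt_de sy ty.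
Qed.

Lemma cell_prism0 n i D : (i < n)%N -> ve (pvert D i) = None ->
  cell R n (prism i D) = 0.
Proof.
move=> le_in v0; apply: cell_nonsimplicial => /(_ i i.+1 ltac:(lia)) [x [] /=].
by rewrite !ltnn !eqxx /= v0.
Qed.

(** The two walls differ only at the vertex i. Edges into it change between [de] and [f0], edges out
    of it between [de] and [f1], and these agree at an unmoved end. *)
Lemma eqs_step_none n i D : simplicial n D -> (i <= n)%N -> ve (pvert D i) = None ->
  eqs n (step i D) (step i.+1 D).
Proof.
move=> s le_in v0; split=> [a an|a b ab] /=.
  rewrite ltnS; have [//|//|->] := ltngtP a i.
  by rewrite ve_none.
have [x [-> sx tx]] := s a b ab; rewrite /=.
have [bi|bi|bi] := ltngtP b i.
- by have -> : (b < i.+1)%N by lia.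
- have -> : (b < i.+1)%N = false by lia.
  have [ia|ia|ia] := ltngtP i a => //.
  by rewrite de_src_none // sx -ia.
have -> : (b < i.+1)%N by lia.
have -> : (i <= a)%N = false by lia.
by rewrite de_tgt_none // tx bi.
Qed.

Lemma diff_prism n i D : simplicial n D -> (i <= n)%N ->
  diff R H n.+1 (cell R n.+1 (prism i D)) =
    \sum_(0 <= j < i) (-1) ^+ j *: cell R n (prism i.-1 (pface j D)) +
    \sum_(i.+1 <= j < n.+1) (-1) ^+ j.+1 *: cell R n (prism i (pface j D)) +
    (-1) ^+ i *: (cell R n (step i D) - cell R n (step i.+1 D)).
Proof.
move=> s le_in; case vi: (ve (pvert D i)) => [x|].
  (* The faces are split into those with j < i, the two at the vertical edge, and those with j > i +
     1. *)
  rewrite diff_cell; last exact: prism_simplicial vi.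
  rewrite (big_cat_nat (n := i)) //=; last lia.
  rewrite [X in _ + X]big_ltn; last lia.
  rewrite [X in _ + (_ + X)]big_ltn; last lia.
  rewrite -addrA; apply: (congr2 +%R).
    apply: eq_big_nat => j ji; congr (_ *: _); apply: cell_eqs.
    by rewrite -{1}(prednK (_ : 0 < i)%N); [apply: pface_prism_le; lia|lia].
  rewrite (cell_eqs _ (pface_prism_eq _ _ _)) (cell_eqs _ (pface_prism_succ _ _ _)).
  rewrite addrA addrC; apply: (congr2 +%R); last first.
    by rewrite scalerBr exprS mulN1r scaleNr.
  rewrite big_add1 /=; apply: eq_big_nat => j ji; congr (_ *: _); apply: cell_eqs.
  by apply: pface_prism_gt; lia.
(* Without a vertical edge both sides vanish: the walls coincide, and the faces in the sums still
   contain the vertex i, now at position i - 1 or i, so their prisms are missing too. *)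
rewrite (@cell_prism0 n.+1) // linear0 (cell_eqs _ (eqs_step_none s le_in vi)).
rewrite subrr scaler0 addr0 !big_nat.
rewrite [X in _ = X + _]big1 => [|j ji]; last first.
  rewrite cell_prism0 ?scaler0 //=; first lia.
  by rewrite /bump; have -> : ((j <= i.-1) + i.-1 = i)%N by lia.
rewrite big1 ?addr0 // => j ji; rewrite cell_prism0 ?scaler0 //=; first lia.
by rewrite /bump; have -> : (j <= i)%N = false by lia.
Qed.

(** With the signs of the prisms the walls telescope, and the other faces regroup into the prisms
    over the boundary by [sum_around_diagonal]. *)
Lemma diff_prism_sum n D : simplicial n D ->
  diff R H n.+1 (\sum_(0 <= i < n.+1) (-1) ^+ i *: cell R n.+1 (prism i D)) =
  cell R n (step 0 D) - cell R n (step n.+1 D) -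
  \sum_(0 <= j < n.+1) (-1) ^+ j *:
     \sum_(0 <= i < n) (-1) ^+ i *: cell R n (prism i (pface j D)).
Proof.
move=> s; pose K i j : chain R H n := (-1) ^+ (i + j) *: cell R n (prism i (pface j D)).
transitivity (\sum_(0 <= i < n.+1)
  (- \sum_(0 <= j < i) K i.-1 j - \sum_(i.+1 <= j < n.+1) K i j +
  (cell R n (step i D) - cell R n (step i.+1 D)))).
  rewrite linear_sum; apply: eq_big_nat => i le_in; rewrite linearZ /= diff_prism //.
  rewrite 2!scalerDr scalerA -exprD addnn -mul2n exprM sqrrN expr1n expr1n.
  rewrite scale1r !scaler_sumr -!sumrN.
  apply: (congr2 +%R) => //; apply: (congr2 +%R); apply: eq_big_nat => j ji.
    rewrite /K scalerA -exprD -scaleNr; congr (_ *: _).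
    by rewrite -[- (_ ^+ _)]mulN1r -exprS; congr (_ ^+ _); lia.
  rewrite /K scalerA -exprD -scaleNr; congr (_ *: _).
  by rewrite -[- (_ ^+ _)]mulN1r -exprS; congr (_ ^+ _); lia.
rewrite big_split [RHS]addrC /=; apply: (congr2 +%R); last first.
  rewrite (@telescope_sumr_eq _ 0 n.+1 (fun i => - cell R n (step i D))) //.
    by rewrite opprK addrC.
  by move=> i _; rewrite opprK addrC.
rewrite sum_around_diagonal; congr (- _); apply: eq_bigr => j _.
rewrite scaler_sumr; apply: eq_bigr => i _.
by rewrite scalerA -exprD addnC.
Qed.

Definition prism_op n : {linear chain R G n -> chain R H n.+1} := linear_ext
  (fun f => \sum_(0 <= i < n.+1) (-1) ^+ i *: cell R n.+1 (prism i (presimplex_of f))).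

Lemma prism_op_cell n D : simplicial n D ->
  prism_op n (cell R n D) = \sum_(0 <= i < n.+1) (-1) ^+ i *: cell R n.+1 (prism i D).
Proof.
move=> s; apply: (@linear_ext_cell _ _ _ _ _ (fun D =>
  \sum_(0 <= i < n.+1) (-1) ^+ i *: cell R n.+1 (prism i D))) => // E E' EE'.
by apply: eq_big_nat => i le_in; rewrite (cell_eqs _ (eqs_prism _ EE')).
Qed.

Lemma cell_step0 n (k : qhom (Delta n) G) :
  cell R n (step 0 (presimplex_of k)) = basis (qcomp f1 k).
Proof.
have [kv ke] := presimplex_ofP k; apply: cell_realizes; split=> [i|e] /=.
  by rewrite kv.
by move: (ke e) => /= <-.
Qed.

Lemma cell_step_last n (k : qhom (Delta n) G) :
  cell R n (step n.+1 (presimplex_of k)) = basis (qcomp f0 k).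
Proof.
have [kv ke] := presimplex_ofP k; apply: cell_realizes; split=> [i|e] /=.
  by rewrite kv ltn_ord.
by rewrite ltn_ord; move: (ke e) => /= <-.
Qed.

Lemma prism_homotopy n z : diff R G n z = 0 ->
  diff R H n.+1 (prism_op n z) = chain_map R f1 n z - chain_map R f0 n z.
Proof.
pose W (k : qhom (Delta n) G) := \sum_(0 <= j < n.+1) (-1) ^+ j *:
  \sum_(0 <= i < n) (-1) ^+ i *: cell R n (prism i (pface j (presimplex_of k))).
have dP c : diff R H n.+1 (prism_op n c) =
    chain_map R f1 n c - chain_map R f0 n c - linear_ext W c.
  apply: (@eq_linear_basis R _ _ (diff R H n.+1 \o prism_op n)%FUN
   (chain_map R f1 n \- chain_map R f0 n \- linear_ext W)) => k.
  rewrite -cell_presimplex_of /= prism_op_cell; last exact: simplicial_presimplex_of.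
  rewrite (@diff_prism_sum n); last exact: simplicial_presimplex_of.
  by rewrite cell_step0 cell_step_last cell_presimplex_of !linear_ext_basis.
move=> dz; rewrite dP; suff -> : linear_ext W z = 0 by rewrite subr0.
(* In degree 0 the inner sum of [W] is empty. In higher degrees the linear extension of [W] is
   [prism_op] after [diff], which kills the cycle. *)
case: n z @W dP dz => [|n] z W dP dz.
  apply: (@eq_linear_basis R _ _ (linear_ext W) \0) => k.
  by rewrite /= linear_ext_basis /W big_nat1 big_geq // scaler0.
rewrite -(linear0 (prism_op n)) -dz.
apply: (@eq_linear_basis R _ _ (linear_ext W) (prism_op n \o diff R G n.+1)%FUN) => k.
rewrite [LHS]linear_ext_basis.
apply: etrans (congr1 (prism_op n) (esym (diff_basis R k))); rewrite linear_sum.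
apply: eq_big_nat => j jn; rewrite linearZ prism_op_cell //.
by apply: simplicial_pface => //; apply: simplicial_presimplex_of.
Qed.

End Prism.

(** * Strong homotopies *)

Section StrongHomotopy.
Variables (G H : quiver) (G' : subquiver G).
Hypothesis fullG' : full_subquiver G'.
Variable F : qhom (strong_cylinder G') H.
Let f0 := qcomp F (cyl_i0 G').
Let f1 := qcomp F (cyl_i1 fullG').

(** An edge from the lower copy of the source to the top copy of the target. If only the target lies
    in [G'], the mixed edge runs this way; if the target lies outside, its top copy is the lower one
    and the edge (e,0) serves. *)
Definition diagonal_edge (e : edge G) : cyl_edge G' :=
  match pselect (sub_edge G' e) with
  | left he => Cyl_edge01 he
  | right _ =>
      match pselect (~ sub_vertex G' (src e) /\ sub_vertex G' (tgt e)) with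
      | left h => Cyl_mixed (or_intror h)
      | right _ => Cyl_edge0 _ e
      end
  end.

Definition vertical_edge (v : vertex G) : option (cyl_edge G') :=
  match pselect (sub_vertex G' v) with
  | left hv => Some (Cyl_vertex01 hv)
  | right _ => None
  end.

Lemma diagonal_src e : cyl_src (diagonal_edge e) = inl (src e).
Proof.
rewrite /diagonal_edge; case: pselect => //= _.
by case: pselect => //= -[hs ht]; rewrite cyl_top_out.
Qed.

Lemma diagonal_tgt e : cyl_tgt (diagonal_edge e) = cyl_top G' (tgt e).
Proof.
rewrite /diagonal_edge; case: pselect => [he|nhe] /=; first by rewrite -cyl_top_in.
case: pselect => //= h; rewrite cyl_top_out // => ht; apply: h; split=> // hs.
by apply: nhe; apply/fullG'.
Qed.

Lemma diagonal_tgt_out e : ~ sub_vertex G' (tgt e) -> diagonal_edge e = Cyl_edge0 _ e.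
Proof.
move=> ht; rewrite /diagonal_edge; case: pselect => [/fullG'[]//|_].
by case: pselect => // -[].
Qed.

Lemma diagonal_src_out e : ~ sub_vertex G' (src e) -> diagonal_edge e = cyl_i1_edge fullG' e.
Proof.
move=> hs; rewrite /diagonal_edge /cyl_i1_edge; case: pselect => [/fullG'[]//|he].
case: pselect => [h|h]; case: pselect => [h'|h'] //.
- by have [_ ht] := h; have [_ []] := h'.
- by congr Cyl_mixed; apply: Prop_irrelevance.
by case: h'; split=> // ht; apply: h.
Qed.

Lemma vertical_edge_none v : omap (emap F) (vertical_edge v) = None -> ~ sub_vertex G' v.
Proof. by rewrite /vertical_edge; case: pselect. Qed.

Lemma cylinder_homotopy (R : comPzRingType) n z : diff R G n z = 0 ->
  exists a, diff R H n.+1 a = chain_map R f1 n z - chain_map R f0 n z.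
Proof.
move=> dz; exists (prism_op R f0 f1 (emap F \o diagonal_edge)
  (omap (emap F) \o vertical_edge) n z).
apply: prism_homotopy dz => [e|e|v x|v|e|e] /=.
- by rewrite src_emap /= diagonal_src.
- by rewrite tgt_emap /= diagonal_tgt.
- rewrite /vertical_edge; case: pselect => //= hv [<-].
  by rewrite src_emap tgt_emap /= (cyl_top_in hv).
- by move=> /vertical_edge_none nv; rewrite cyl_top_out.
- by move=> /vertical_edge_none /diagonal_tgt_out ->.
- by move=> /vertical_edge_none /diagonal_src_out ->.
Qed.

End StrongHomotopy.

Lemma lSh_equivalent1_homology (R : comPzRingType) (G1 G2 : quiver) :
  lSh_equivalent1 G1 G2 -> homology_isomorphic R G1 G2.
Proof.
move=> [f [g [[G1' [full1 [F1 [F10 F11]]]] [G2' [full2 [F2 [F20 F21]]]]]]].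
apply: (@homology_equivalence _ _ _ f g) => n z dz.
  have [a] := cylinder_homotopy full1 F1 dz.
  by rewrite F10 F11 chain_map_id; exists a.
have [a] := cylinder_homotopy full2 F2 dz.
by rewrite F20 F21 chain_map_id; exists a.
Qed.

(** * Insertion of a vertex in front of a loop vertex *)

(** Meant for [A j] the faces of a simplex with an inserted vertex and [B j] the insertions into
    faces. Behind the window the insertion shifts face indices by one, hence [A j.+1] there. *)
Lemma sum_cancel_ends (V : zmodType) (n p z : nat) (A B : nat -> V) :
  (p <= z < n.+2)%N -> (forall j, (j < p)%N -> A j = - B j) ->
  (forall j, (z < j < n.+2)%N -> A j.+1 = - B j) ->
  \sum_(0 <= j < n.+3) A j + \sum_(0 <= j < n.+2) B j =
  \sum_(p <= j < z.+2) A j + \sum_(p <= j < z.+1) B j.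
Proof.
move=> pz lowA highA.
rewrite (big_cat_nat (n := p)) //=; last lia.
rewrite [\sum_(p <= j < n.+3) A j](big_cat_nat (n := z.+2)) //=; try lia.
rewrite [\sum_(0 <= j < n.+2) B j](big_cat_nat (n := p)) //=; last lia.
rewrite [\sum_(p <= j < n.+2) B j](big_cat_nat (n := z.+1)) //=; try lia.
rewrite [\sum_(z.+2 <= j < n.+3) A j]big_add1 /=.
have -> : \sum_(0 <= j < p) A j = - \sum_(0 <= j < p) B j.
  by rewrite -sumrN; apply: eq_big_nat => j jp; apply: lowA.
have -> : \sum_(z.+1 <= j < n.+2) A j.+1 = - \sum_(z.+1 <= j < n.+2) B j.
  by rewrite -sumrN; apply: eq_big_nat => j jp; apply: highA.
rewrite addrACA addNr add0r -addrA; congr (_ + _).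
by rewrite addrCA addNr addr0.
Qed.

(** Apart from the leading 1 of the first sum, the two sums cancel term by term, whatever the parity
    of m. *)
Lemma sum_sign_consecutive (R : pzRingType) m :
  \sum_(0 <= i < m.+1) (-1) ^+ i + \sum_(0 <= i < m) (-1) ^+ i = 1 :> R.
Proof.
rewrite big_nat_recl //= expr0 -addrA -[RHS]addr0; congr (_ + _).
rewrite -[X in X + _](eq_bigr _ (fun i _ => esym (exprS (-1) i))) -mulr_sumr.
by rewrite mulN1r addNr.
Qed.

Section Insertion.
(** [VL] will be the set of vertices whose loop is removed. The three hypotheses are what the
    insertion argument takes from degeneracy. *)
Variables (R : comPzRingType) (G : quiver) (VL : vertex G -> Prop).
Hypothesis edge_unique : forall v e e', VL v -> src e = v \/ tgt e = v ->
  src e = src e' -> tgt e = tgt e' -> e = e'.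
Hypothesis loop_between : forall v u e e', VL v -> u <> v ->
  src e = v -> tgt e = u -> src e' = u -> tgt e' = v ->
  ~ VL u /\ exists l, src l = u /\ tgt l = u.
Hypothesis loop_exists : forall v, VL v -> exists l, src l = v /\ tgt l = v.
Implicit Types (n j p q z : nat) (u w : vertex G) (D E : presimplex G).

Definition some_edge u w : option (edge G) :=
  match pselect (exists e, src e = u /\ tgt e = w) with
  | left h => Some (projT1 (cid h))
  | right _ => None
  end.

Lemma some_edgeP u w : (exists e, src e = u /\ tgt e = w) ->
  exists e, [/\ some_edge u w = Some e, src e = u & tgt e = w].
Proof.
rewrite /some_edge => h; case: pselect => // h'.
by case: cid => e /= [se te]; exists e.
Qed.

(** A simplex is pulled back along this map on insertion. The map fails to be increasing only from
    the new position p to the positions p + 1 to q + 1, and there [some_edge] has to supply the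
    edge. *)
Definition copy_index p q a : nat :=
  if (a < p)%N then a else if a == p then q else a.-1.

(* [insert p q D] puts a copy of the [q]-th vertex in front of the [p]-th one,
   for [p <= q]. *)
Definition insert p q D : presimplex G := Presimplex
  (pvert D \o copy_index p q)
  (fun a b => let a' := copy_index p q a in let b' := copy_index p q b in
    if (a' < b')%N then pedge D a' b' else some_edge (pvert D a') (pvert D b')).

(** At most one occurrence. Two occurrences of u in a simplex are joined by a loop at u, so this
    says that the simplex uses no such loop. *)
Definition once u n D : Prop :=
  forall a b, (a < b <= n)%N -> pvert D a = u -> pvert D b <> u.

Lemma eqs_once u n D E : eqs n D E -> once u n D -> once u n E.
Proof.
move=> [v _] o a b ab; rewrite -(v a); last lia.
by rewrite -(v b); [exact: o|lia].
Qed.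

Lemma once_pface u n D j : once u n.+1 D -> once u n (pface j D).
Proof. by move=> o a b ab /=; apply: o; rewrite /bump; lia. Qed.

Lemma eqs_insert n p q D E : (p <= q <= n)%N -> eqs n D E ->
  eqs n.+1 (insert p q D) (insert p q E).
Proof.
move=> pq [v e]; split=> [a an|a b ab] /=.
  by rewrite v // /copy_index; case: ifP; [lia|case: ifP; lia].
have ca c : (c <= n.+1)%N -> (copy_index p q c <= n)%N.
  by move=> cn; rewrite /copy_index; case: ifP; [lia|case: ifP; lia].
have an := ca a ltac:(lia); have bn := ca b ltac:(lia).
by case: ifP => lt; [rewrite e //; lia|rewrite !v].
Qed.

Section Vertex.
Variable v : vertex G.
Hypothesis VLv : VL v.

(* [p] and [z] are the first and last occurrences of [v], assumed distinct; [q]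
   is the first index between them carrying another vertex, or [p] if there is
   none. *)
Record window n D p q z : Prop := Window {
  win_lt : (p <= q < z)%N;
  win_le : (z <= n)%N;
  win_first : pvert D p = v;
  win_last : pvert D z = v;
  win_before : forall a, (a < p)%N -> pvert D a <> v;
  win_after : forall a, (z < a <= n)%N -> pvert D a <> v;
  win_prefix : forall a, (p <= a < q)%N -> pvert D a = v;
  win_pivot : (q = p /\ forall a, (p <= a <= z)%N -> pvert D a = v) \/ pvert D q <> v }.

Lemma win_pivot_lt n D p q z : window n D p q z -> pvert D q <> v -> (p < q)%N.
Proof.
move=> W nq; have := win_lt W; have [//|lt|eq] := ltngtP p q; first lia.
by case: nq; rewrite -eq; apply: win_first W.
Qed.

Lemma win_pure n D p z : window n D p p z -> forall a, (p <= a <= z)%N -> pvert D a = v.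
Proof. by move=> W; case: (win_pivot W) => [[]//|[]]; apply: win_first W. Qed.

Lemma win_nonpure n D p q z : window n D p q z -> (p < q)%N -> pvert D q <> v.
Proof. by move=> W pq; case: (win_pivot W) => // -[e]; move: pq; rewrite e ltnn. Qed.

Lemma window_not_once n D p q z : window n D p q z -> ~ once v n D.
Proof.
move=> W /(_ p z); have := win_lt W; have := win_le W => zn pz o.
by apply: o (win_first W) (win_last W); lia.
Qed.

Lemma windowP n D : (exists p q z, window n D p q z) \/ once v n D.
Proof.
have [|no] := pselect (once v n D); [by right|left].
have [a [b [ab va vb]]] : exists a b, [/\ (a < b <= n)%N, pvert D a = v & pvert D b = v].
  apply: contrapT => h; apply: no => a b ab va vb; apply: h.
  by exists a, b.
have exP : exists i, `[< pvert D i = v >] by exists a; apply/asboolP.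
have exZ : exists i, (i <= n)%N && `[< pvert D i = v >].
  by exists b; apply/andP; split; [lia|apply/asboolP].
case: (ex_minnP exP) => p /asboolP vp minp.
case: (@ex_maxnP (fun i => (i <= n)%N && `[< pvert D i = v >]) n exZ) => [i /andP[]//|].
move=> z /andP[zn /asboolP vz] maxz.
have pa : (p <= a)%N by apply: minp; apply/asboolP.
have bz : (b <= z)%N by apply: maxz; apply/andP; split; [lia|apply/asboolP].
have before i : (i < p)%N -> pvert D i <> v.
  by move=> ip /asboolP/minp; lia.
have after i : (z < i <= n)%N -> pvert D i <> v.
  move=> iz /asboolP vi; have := maxz i; rewrite vi; lia.
have [[i [pi iz nvi]]|pure] :=
    pselect (exists i, [/\ (p <= i)%N, (i <= z)%N & pvert D i <> v]).
  have exQ : exists i, (p <= i)%N && ~~ `[< pvert D i = v >].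
    by exists i; rewrite pi; apply/asboolPn.
  case: (ex_minnP exQ) => q /andP[pq /asboolPn nvq] minq.
  have qi : (q <= i)%N by apply: minq; rewrite pi; apply/asboolPn.
  have qz : q != z by apply/eqP => e; apply: nvq; rewrite e.
  exists p, q, z; split=> //; [lia| |by right].
  by move=> c pcq; apply: contrapT => /asboolPn nvc; have := minq c; rewrite nvc; lia.
exists p, p, z; split=> //; [lia|lia|left; split=> // c pcz].
apply: contrapT => nvc; apply: pure; exists c; split=> //; lia.
Qed.

Lemma window_inj n D p q z p' q' z' :
  window n D p q z -> window n D p' q' z' -> [/\ p = p', q = q' & z = z'].
Proof.
move=> W W'.
have := win_lt W; have := win_lt W'; have := win_le W; have := win_le W' => zn' zn pz' pz.
have ep : p = p'.
  have [lt|lt|//] := ltngtP p p'.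
    by case: (win_before W' lt); apply: win_first W.
  by case: (win_before W lt); apply: win_first W'.
have ez : z = z'.
  have [lt|lt|//] := ltngtP z z'.
    by case: (@win_after _ _ _ _ _ W z' ltac:(lia)); apply: win_last W'.
  by case: (@win_after _ _ _ _ _ W' z ltac:(lia)); apply: win_last W.
subst p' z'; split=> //.
have [lt|lt|//] := ltngtP q q'.
  have vq := @win_prefix _ _ _ _ _ W' q ltac:(lia).
  case: (win_pivot W) => [[e pure]|//].
  by case: (win_nonpure W' ltac:(lia)); apply: pure; lia.
have vq := @win_prefix _ _ _ _ _ W q' ltac:(lia).
case: (win_pivot W') => [[e pure]|//].
by case: (win_nonpure W ltac:(lia)); apply: pure; lia.
Qed.

Lemma eqs_window n D E p q z : eqs n D E -> window n D p q z -> window n E p q z.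
Proof.
move=> [ev _] W; have := win_lt W; have := win_le W => zn pz.
split=> //.
- by rewrite -ev; [apply: win_first W|lia].
- by rewrite -ev; [apply: win_last W|lia].
- by move=> a ap; rewrite -ev; [apply: win_before W _ _|lia].
- by move=> a az; rewrite -ev; [apply: win_after W _ _|lia].
- by move=> a ap; rewrite -ev; [apply: win_prefix W _ _|lia].
case: (win_pivot W) => [[e pure]|nq]; [left|right]; last by rewrite -ev //; lia.
by split=> // a az; rewrite -ev; [apply: pure|lia].
Qed.

(** Let w be the vertex at q. The new edges go from the copy of w to the positions originally p to
    q. Those before q carry v, and the edge from q to z runs from w to v. At q a loop at w is
    needed: [loop_between] gives it from the edges p to q and q to z, or [loop_exists] if w = v. *)
Lemma insert_simplicial n D p q z : simplicial n D -> window n D p q z ->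
  simplicial n.+1 (insert p q D).
Proof.
move=> s W a b ab; have := win_lt W; have := win_le W => zn pz.
have ca c : (c <= n.+1)%N -> (copy_index p q c <= n)%N.
  by move=> cn; rewrite /copy_index; case: ifP; [lia|case: ifP; lia].
rewrite /=; case: ifP => lt; first by apply: s; rewrite lt ca //; lia.
apply: some_edgeP.
have [ea eq_a] : a = p /\ copy_index p q a = q.
  move: lt; rewrite /copy_index; repeat case: ifP; lia.
have eb : copy_index p q b = b.-1 by rewrite /copy_index; repeat case: ifP; lia.
rewrite eq_a eb; move: lt; rewrite eq_a eb => lt.
have [qz [_ sqz tqz]] := s q z ltac:(lia).
have [bq|bq] := ltnP b.-1 q.
  exists qz; rewrite sqz tqz (win_last W); split=> //.
  by rewrite (@win_prefix _ _ _ _ _ W) //; lia.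
have -> : b.-1 = q by lia.
have [vq|nvq] := pselect (pvert D q = v); first by rewrite vq; apply: loop_exists.
have pq := win_pivot_lt W nvq.
have [pq_e [_ spq tpq]] := s p q ltac:(lia).
have [//|_ //] := loop_between VLv nvq (etrans spq (win_first W)) tpq sqz.
by rewrite tqz; apply: win_last W.
Qed.

(** * Faces of an insertion and windows of faces *)

Lemma pface_insert_lt n D p q j : (j < p <= q)%N ->
  eqs n (pface j (insert p q D)) (insert p.-1 q.-1 (pface j D)).
Proof.
move=> jp; have e a : copy_index p q (bump j a) = bump j (copy_index p.-1 q.-1 a).
  by rewrite /copy_index /bump; repeat case: ifP; lia.
split=> [a an|a b ab] /=; first by rewrite e.
by rewrite !e; congr (if _ then _ else _); rewrite /bump; lia.
Qed.

Lemma pface_insert_gt n D p q j : (p <= q < j)%N ->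
  eqs n (pface j.+1 (insert p q D)) (insert p q (pface j D)).
Proof.
move=> jp; have e a : copy_index p q (bump j.+1 a) = bump j (copy_index p q a).
  by rewrite /copy_index /bump; repeat case: ifP; lia.
split=> [a an|a b ab] /=; first by rewrite e.
by rewrite !e; congr (if _ then _ else _); rewrite /bump; lia.
Qed.

Lemma pface_insert_eq n D p q : eqs n (pface p (insert p q D)) D.
Proof.
have e a : copy_index p q (bump p a) = a.
  by rewrite /copy_index /bump; repeat case: ifP; lia.
split=> [a an|a b ab] /=; first by rewrite e.
by rewrite !e; case: ifP => //; lia.
Qed.

Lemma window_pface_lt n D p q z j : (j < p)%N -> window n.+1 D p q z ->
  window n (pface j D) p.-1 q.-1 z.-1.
Proof.
move=> jp W; have := win_lt W; have := win_le W => zn pz.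
have E a : (j < a)%N -> bump j a.-1 = a by rewrite /bump; lia.
split=> /=; rewrite ?E; try lia.
- exact: win_first W.
- exact: win_last W.
- by move=> a ap; apply: win_before W _ _; rewrite /bump; lia.
- by move=> a ap; apply: win_after W _ _; rewrite /bump; lia.
- by move=> a ap; apply: win_prefix W _ _; rewrite /bump; lia.
case: (win_pivot W) => [[e pure]|nq]; [left|by right].
by split; [lia|move=> a az; apply: pure; rewrite /bump; lia].
Qed.

Lemma window_pface_gt n D p q z j : (z < j <= n.+1)%N -> window n.+1 D p q z ->
  window n (pface j D) p q z.
Proof.
move=> jp W; have := win_lt W; have := win_le W => zn pz.
have E a : (a < j)%N -> bump j a = a by rewrite /bump; lia.
split=> /=; rewrite ?E; try lia.
- exact: win_first W.
- exact: win_last W.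
- by move=> a ap; apply: win_before W _ _; rewrite /bump; lia.
- by move=> a ap; apply: win_after W _ _; rewrite /bump; lia.
- by move=> a ap; apply: win_prefix W _ _; rewrite /bump; lia.
case: (win_pivot W) => [[e pure]|nq]; [left|by right].
by split; [lia|move=> a az; apply: pure; rewrite /bump; lia].
Qed.

Lemma window_pface_pure n D p z j : (p <= j <= z)%N -> (p.+1 < z)%N ->
  window n.+1 D p p z -> window n (pface j D) p p z.-1.
Proof.
move=> jp pz1 W; have := win_lt W; have := win_le W => zn pz.
have pure := win_pure W.
split=> /=; try lia.
- by apply: pure; rewrite /bump; lia.
- by apply: pure; rewrite /bump; lia.
- by move=> a ap; apply: win_before W _ _; rewrite /bump; lia.
- by move=> a ap; apply: win_after W _ _; rewrite /bump; lia.
left; split=> // a ap; apply: pure; rewrite /bump; lia.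
Qed.

Lemma window_pface_bounds n D p q z j p' q' z' : (p <= j <= z)%N ->
  window n.+1 D p q z -> window n (pface j D) p' q' z' -> (p <= p')%N /\ (z' < z)%N.
Proof.
move=> jp W W'; have := win_lt W'; have := win_le W' => zn' pz'.
split; rewrite leqNgt; apply/negP => lt.
  have e : bump j p' = p' by rewrite /bump; lia.
  by case: (win_before W lt); have := win_first W'; rewrite /= e.
have e : bump j z' = z'.+1 by rewrite /bump; lia.
case: (@win_after _ _ _ _ _ W z'.+1); first lia.
by have := win_last W'; rewrite /= e.
Qed.

(** An edge with an end at v is determined by its two ends, by [edge_unique]. *)
Lemma eqs_off_vertex n D E : simplicial n D -> simplicial n E ->
  (forall a, (a <= n)%N -> pvert D a = pvert E a) ->
  (forall a b, (a < b <= n)%N -> pvert D a <> v -> pvert D b <> v ->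
    pedge D a b = pedge E a b) -> eqs n D E.
Proof.
move=> sD sE ev ee; split=> // a b ab.
have [x [ex sx tx]] := sD a b ab; have [y [ey sy ty]] := sE a b ab.
have [va|nva] := pselect (pvert D a = v); last first.
  have [vb|nvb] := pselect (pvert D b = v); last exact: ee.
  rewrite ex ey; congr Some; apply: (edge_unique VLv).
  - by right; rewrite tx.
  - by rewrite sx sy; apply: ev; lia.
  by rewrite tx ty; apply: ev; lia.
rewrite ex ey; congr Some; apply: (edge_unique VLv).
- by left; rewrite sx.
- by rewrite sx sy; apply: ev; lia.
by rewrite tx ty; apply: ev; lia.
Qed.

(** Whichever copy of v is deleted from the enlarged block, the vertices are those of D again, and
    the edges off v are untouched. *)
Lemma pface_insert_pure n D p z j : simplicial n D -> window n D p p z ->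
  (p <= j <= z.+1)%N -> eqs n (pface j (insert p p D)) D.
Proof.
move=> s W jp; have := win_lt W; have := win_le W => zn pz.
have pure := win_pure W.
have e a : copy_index p p (bump j a) = a \/
    (p <= a <= z)%N /\ (p <= copy_index p p (bump j a) <= z)%N.
  by rewrite /copy_index /bump; repeat case: ifP; lia.
apply: eqs_off_vertex => //.
- by apply: simplicial_pface; [lia|apply: insert_simplicial W].
- by move=> a an /=; case: (e a) => [->//|[az az']]; rewrite !pure.
move=> a b ab /=; case: (e a) => [->|[_ /pure ->]//] _.
by case: (e b) => [->|[_ /pure ->]//] _; case: ifP => //; lia.
Qed.

Lemma insert_pface_pure n D p z j : simplicial n.+1 D -> window n.+1 D p p z ->
  (p <= j <= z)%N -> (p.+1 < z)%N -> eqs n.+1 (insert p p (pface j D)) D.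
Proof.
move=> s W jp pz1; have := win_lt W; have := win_le W => zn pz.
have pure := win_pure W.
have W' := window_pface_pure jp pz1 W.
have e a : bump j (copy_index p p a) = a \/
    (p <= a <= z)%N /\ (p <= bump j (copy_index p p a) <= z)%N.
  by rewrite /copy_index /bump; repeat case: ifP; lia.
apply: eqs_off_vertex => //.
- by apply: insert_simplicial W'; apply: simplicial_pface => //; lia.
- by move=> a an /=; case: (e a) => [->//|[az az']]; rewrite !pure.
move=> a b ab /= nva nvb; case: (e a) => [ea|[_ /pure ea]]; last by case: nva; rewrite ea.
case: (e b) => [eb|[_ /pure eb]]; last by case: nvb; rewrite eb.
have -> : (copy_index p p a < copy_index p p b)%N by move: ea eb; rewrite /bump; lia.
by rewrite ea eb.
Qed.

(** A partial contracting homotopy: the insertion, signed by its position. Windows are unique by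
    [window_inj], so the choice is harmless. *)
Definition push n D : chain R G n.+1 :=
  match pselect (exists x : nat * nat * nat, window n D x.1.1 x.1.2 x.2) with
  | left h => let: (p, q, _) := projT1 (cid h) in
      (-1) ^+ p *: cell R n.+1 (insert p q D)
  | right _ => 0
  end.

Lemma push_window n D p q z : window n D p q z ->
  push n D = (-1) ^+ p *: cell R n.+1 (insert p q D).
Proof.
rewrite /push => W; case: pselect => [h|[]]; last by exists (p, q, z).
by case: cid => -[[p' q'] z'] /= /(window_inj W) [-> -> _].
Qed.

Lemma push_once n D : once v n D -> push n D = 0.
Proof.
by rewrite /push => o; case: pselect => // -[[[p q] z] W]; case: (window_not_once W).
Qed.

Lemma push_eqs n D E : eqs n D E -> push n D = push n E.
Proof.
move=> DE; have [[p [q [z W]]]|o] := windowP n D; last first.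
  by rewrite !push_once //; apply: eqs_once DE o.
rewrite (push_window W) (push_window (eqs_window DE W)).
congr (_ *: _); apply: cell_eqs; apply: eqs_insert DE.
by have := win_lt W; have := win_le W; lia.
Qed.

(** A strict bound: a window of v alone counts 0, any other one counts its length. Hence level 0
    excludes windows altogether and means that v occurs at most once. *)
Definition level n D N : Prop :=
  forall p q z, window n D p q z -> ((if p < q then z - p else 0) < N)%N.

Lemma eqs_level n D E N : eqs n D E -> level n D N -> level n E N.
Proof. by move=> DE lD p q z /(eqs_window (eqs_sym DE)); apply: lD. Qed.

(** The inserted vertex survives at p and differs from v, so the window starts later, while deleting
    one position up to z + 1 brings its end back to z at most. *)
Lemma level_pface_insert n D p q z j : window n.+1 D p q z -> (p < q)%N ->
  (p < j <= z.+1)%N -> level n.+1 (pface j (insert p q D)) (z - p).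
Proof.
move=> W pq jp p' q' z' W'.
have := win_lt W; have := win_le W; have := win_lt W'; have := win_le W'.
move=> zn' pz' zn pz.
have p'p : (p < p')%N.
  rewrite ltnNge; apply/negP => le; have := win_first W'.
  have [lt|eq] : (p' < p)%N \/ p' = p by lia.
    have -> : pvert (pface j (insert p q D)) p' = pvert D p'.
      by rewrite /= /copy_index /bump; congr pvert; repeat case: ifP; lia.
    exact: win_before W _ lt.
  have -> : pvert (pface j (insert p q D)) p' = pvert D q.
    by rewrite /= /copy_index /bump; congr pvert; repeat case: ifP; lia.
  exact: win_nonpure W pq.
have z'z : (z' <= z)%N.
  rewrite leqNgt; apply/negP => lt; have := win_last W'.
  have -> : pvert (pface j (insert p q D)) z' = pvert D z'.
    by rewrite /= /copy_index /bump; congr pvert; repeat case: ifP; lia.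
  by apply: win_after W _ _; lia.
by case: ifP; lia.
Qed.

(** If the inserted vertex is not v, the window moves right by one without growing. Otherwise it
    grows but consists of v alone and counts 0. *)
Lemma level_insert n D p q z N : window n D p q z -> (0 < N)%N -> (z - p < N)%N ->
  level n.+1 (insert p q D) N.
Proof.
move=> W N0 ltN p' q' z' W'.
have := win_lt W; have := win_le W; have := win_lt W'; have := win_le W'.
move=> zn' pz' zn pz; case: ifP => // pq'.
have z'z : (z' <= z.+1)%N.
  rewrite leqNgt; apply/negP => lt; have := win_last W'.
  have -> : pvert (insert p q D) z' = pvert D z'.-1.
    by rewrite /= /copy_index; congr pvert; repeat case: ifP; lia.
  by apply: win_after W _ _; lia.
have p'p : (p <= p')%N.
  rewrite leqNgt; apply/negP => lt; have := win_first W'.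
  have -> : pvert (insert p q D) p' = pvert D p'.
    by rewrite /= /copy_index; congr pvert; repeat case: ifP; lia.
  exact: win_before W _ lt.
have [pq|eq] : (p < q)%N \/ q = p by lia.
  have [|eq] : (p < p')%N \/ p' = p by lia.
    by lia.
  case: (win_nonpure W pq); rewrite -(win_first W') eq.
  by rewrite /= /copy_index; congr pvert; repeat case: ifP; lia.
subst q; case: (win_nonpure W' pq') => /=; apply: (win_pure W).
by rewrite /copy_index; repeat case: ifP; lia.
Qed.

(** The copied vertex is v or, by [loop_between], lies outside [VL]. So treating v does not undo
    what was achieved for other vertices of [VL]. *)
Lemma once_insert n D p q z u : window n D p q z -> VL u -> u <> v ->
  simplicial n D -> once u n D -> once u n.+1 (insert p q D).
Proof.
move=> W VLu uv s o a b ab /= ua ub; have := win_lt W; have := win_le W => zn pz.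
have ca c : (c <= n.+1)%N -> (copy_index p q c <= n)%N.
  by move=> cn; rewrite /copy_index; case: ifP; [lia|case: ifP; lia].
have an := ca a ltac:(lia); have bn := ca b ltac:(lia).
have [lt|lt|eq] := ltngtP (copy_index p q a) (copy_index p q b).
- by case: (o _ _ _ ua ub); rewrite lt.
- by case: (o _ _ _ ub ua); rewrite lt.
have eq_a : copy_index p q a = q by move: eq; rewrite /copy_index; repeat case: ifP; lia.
rewrite eq_a in ua; have [vq|nvq] := pselect (pvert D q = v).
  by apply: uv; rewrite -ua.
have pq := win_pivot_lt W nvq.
have [e [_ se te]] := s p q ltac:(lia); have [e' [_ se' te']] := s q z ltac:(lia).
have [nVL _] := loop_between VLv nvq (etrans se (win_first W)) te se'
  (etrans te' (win_last W)).
by apply: nVL; rewrite ua.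
Qed.

(** Only faces inside the window remain. In front of it the insertion position, and with it the sign
    of [push], changes; behind it the face index changes. *)
Lemma diff_push n D p q z : simplicial n.+1 D -> window n.+1 D p q z ->
  diff R G n.+2 (push n.+1 D) +
    \sum_(0 <= j < n.+2) (-1) ^+ j *: push n (pface j D) =
  \sum_(p <= j < z.+2) (-1) ^+ (p + j) *: cell R n.+1 (pface j (insert p q D)) +
    \sum_(p <= j < z.+1) (-1) ^+ j *: push n (pface j D).
Proof.
move=> s W; have := win_lt W; have := win_le W => zn pz.
rewrite (push_window W) linearZ diff_cell; last exact: insert_simplicial W.
rewrite [X in X + _ = _]scaler_sumr.
rewrite (eq_bigr (fun j => (-1) ^+ (p + j) *: cell R n.+1 (pface j (insert p q D))));
  last by move=> j _; rewrite scalerA exprD.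
apply: sum_cancel_ends => [|j jp|j jz]; first lia.
  rewrite (push_window (window_pface_lt jp W)) scalerA -exprD.
  rewrite (cell_eqs _ (pface_insert_lt _ _ _)); last lia.
  rewrite -scaleNr; congr (_ *: _).
  by rewrite -[- (_ ^+ _)]mulN1r -exprS; congr (_ ^+ _); lia.
rewrite (push_window (window_pface_gt jz W)) scalerA -exprD.
rewrite (cell_eqs _ (pface_insert_gt _ _ _)); last lia.
rewrite -scaleNr; congr (_ *: _).
by rewrite -[- (_ ^+ _)]mulN1r -exprS; congr (_ ^+ _); lia.
Qed.

Lemma diff_push_pure n D p z : simplicial n.+1 D -> window n.+1 D p p z ->
  diff R G n.+2 (push n.+1 D) +
    \sum_(0 <= j < n.+2) (-1) ^+ j *: push n (pface j D) = cell R n.+1 D.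
Proof.
move=> s W; have := win_lt W; have := win_le W => zn pz.
have sign i : (-1) ^+ (p + (i + p)) = (-1) ^+ i :> R.
  by rewrite addnCA exprD addnn -mul2n exprM sqrrN expr1n expr1n mulr1.
rewrite (diff_push s W).
have -> : \sum_(p <= j < z.+2) (-1) ^+ (p + j) *: cell R n.+1 (pface j (insert p p D)) =
    (\sum_(0 <= i < (z.+1 - p).+1) (-1) ^+ i) *: cell R n.+1 D.
  rewrite -{1}[p]add0n big_addn scaler_suml subSn; last lia.
  apply: eq_big_nat => i ip; rewrite sign; congr (_ *: _); apply: cell_eqs.
  by apply: pface_insert_pure W _ => //; lia.
have -> : \sum_(p <= j < z.+1) (-1) ^+ j *: push n (pface j D) =
    (\sum_(0 <= i < z.+1 - p) (-1) ^+ i) *: cell R n.+1 D.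
  (* If z = p + 1, a face inside the window keeps v only once, so the pushes vanish, as does the sum
     of the two signs. *)
  have [pz1|zp] := ltnP p.+1 z; last first.
    have -> : (z.+1 - p = 2)%N by lia.
    rewrite [X in _ = X *: _]big_ltn // big_nat1 expr0 expr1 subrr scale0r.
    rewrite big_nat big1 // => j jp; rewrite push_once ?scaler0 //.
    case: (windowP n (pface j D)) => // -[p' [q' [z' W']]].
    by have := window_pface_bounds jp W W'; have := win_lt W'; lia.
  rewrite -{1}[p]add0n big_addn scaler_suml.
  apply: eq_big_nat => i ip.
  rewrite (push_window (window_pface_pure _ pz1 W)); last lia.
  rewrite scalerA -exprD addnC sign; congr (_ *: _); apply: cell_eqs.
  by apply: insert_pface_pure W _ _ => //; lia.
by rewrite -scalerDl sum_sign_consecutive scale1r.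
Qed.

Definition residue n D : chain R G n.+1 :=
  cell R n.+1 D - (diff R G n.+2 (push n.+1 D) +
    \sum_(0 <= j < n.+2) (-1) ^+ j *: push n (pface j D)).

Lemma residue_supported n D p q z (P : vertex G -> Prop) :
  simplicial n.+1 D -> window n.+1 D p q z -> (p < q)%N ->
  (forall u, P u -> [/\ VL u, u <> v & once u n.+1 D]) ->
  supported (fun k : qhom (Delta n.+1) G => level n.+1 (presimplex_of k) (z - p) /\
    forall u, P u -> once u n.+1 (presimplex_of k)) (residue n D).
Proof.
move=> s W pq Pu; have := win_lt W; have := win_le W => zn pz.
(* The face at j = p removes the inserted vertex; it is D with sign (-1)^(2p) = 1 and cancels the
   leading cell. *)
rewrite /residue (diff_push s W) big_ltn; last lia.
rewrite (cell_eqs _ (pface_insert_eq _ _ _ _)) addnn -mul2n exprM sqrrN expr1n expr1n.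
rewrite scale1r -addrA opprD addNKr; apply: supportedN; apply: supportedD.
  rewrite big_nat; apply: supported_sum => j jp; apply: supportedZ.
  apply: supported_cell => k /realizes_eqs /eqs_sym ek; split.
    by apply: eqs_level ek _; apply: level_pface_insert W _ _.
  move=> u /Pu[VLu uv ou]; apply: eqs_once ek _; apply: once_pface.
  exact: once_insert W _ _ _ _.
rewrite big_nat; apply: supported_sum => j jp; apply: supportedZ.
case: (windowP n (pface j D)) => [[p' [q' [z' W']]]|o]; last first.
  by rewrite push_once //; apply: supported0.
rewrite (push_window W'); apply: supportedZ.
apply: supported_cell => k /realizes_eqs /eqs_sym ek; split.
  have bounds := window_pface_bounds jp W W'; have := win_lt W' => pz'.
  by apply: eqs_level ek _; apply: level_insert W' _ _; lia.
move=> u /Pu[VLu uv ou]; apply: eqs_once ek _.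
apply: once_insert W' _ _ _ _ => //; last exact: once_pface.
by apply: simplicial_pface => //; lia.
Qed.

(** * Clearing repeated vertices from chains *)

Definition push_op n : {linear chain R G n -> chain R G n.+1} :=
  linear_ext (fun k => push n (presimplex_of k)).

Lemma push_op_cell n D : simplicial n D -> push_op n (cell R n D) = push n D.
Proof. by move=> s; apply: (linear_ext_cell s (h := push n)) => E E'; apply: push_eqs. Qed.

Definition residue_op n : {linear chain R G n.+1 -> chain R G n.+1} :=
  idfun \- ((diff R G n.+2 \o push_op n.+1) \+ (push_op n \o diff R G n.+1)).

Lemma residue_op_basis n (k : qhom (Delta n.+1) G) :
  residue_op n (basis k) = residue n (presimplex_of k).
Proof.
have s := simplicial_presimplex_of k.
rewrite /residue cell_presimplex_of -[push n.+1 _]push_op_cell // cell_presimplex_of.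
congr (_ - (_ + _)); apply: etrans (congr1 (push_op n) (diff_basis R k)) _.
rewrite linear_sum; apply: eq_big_nat => j jn; rewrite linearZ push_op_cell //.
exact: simplicial_pface.
Qed.

(** [push_op] kills the boundary of c, so the new chain is the residue of c. The residue of a
    simplex has smaller level, is 0 if the window consists of v alone, and is the simplex itself if
    there is no window. *)
Lemma push_step n (P : vertex G -> Prop) N (c : chain R G n.+1) :
  (forall u, P u -> VL u /\ u <> v) ->
  supported (fun k => level n.+1 (presimplex_of k) N.+1 /\
    forall u, P u -> once u n.+1 (presimplex_of k)) c ->
  supported (fun k => once v n (presimplex_of k)) (diff R G n.+1 c) ->
  supported (fun k => level n.+1 (presimplex_of k) N /\
    forall u, P u -> once u n.+1 (presimplex_of k))
    (c - diff R G n.+2 (push_op n.+1 c)).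
Proof.
move=> PV sc sdc.
have push0 : push_op n (diff R G n.+1 c) = 0.
  apply: (@linear_on_supported _ _ _ _ _ (push_op n) \0 sdc) => k ok.
  by apply: etrans (linear_ext_basis _ _) (push_once ok).
have -> : c - diff R G n.+2 (push_op n.+1 c) = residue_op n c.
  by rewrite /residue_op /= [linear_ext (fun k => push n _) _]push0 addr0.
apply: supported_linear sc _ => k [lev oP]; rewrite residue_op_basis.
have s := simplicial_presimplex_of k.
case: (windowP n.+1 (presimplex_of k)) => [[p [q [z W]]]|o].
  have [pq|eq] : (p < q)%N \/ q = p by have := win_lt W; lia.
    apply: supported_sub (residue_supported s W pq (P := P) _); last first.
      by move=> u Pu; have [? ?] := PV u Pu; split=> //; apply: oP.
    move=> l [lev' o']; split=> // p' q' z' W'.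
    by have := lev' _ _ _ W'; have := lev _ _ _ W; rewrite pq; case: ifP; lia.
  subst q; rewrite /residue (diff_push_pure s W) subrr; exact: supported0.
rewrite /residue push_once // linear0 big_nat big1 => [|j jn]; last first.
  by rewrite push_once ?scaler0 //; apply: once_pface.
rewrite add0r subr0 cell_presimplex_of; apply: supported_basis; split=> //.
by move=> p q z W; case: (window_not_once W).
Qed.

Lemma level_iter n (P : vertex G -> Prop) N (c : chain R G n.+1) :
  (forall u, P u -> VL u /\ u <> v) ->
  supported (fun k => level n.+1 (presimplex_of k) N /\
    forall u, P u -> once u n.+1 (presimplex_of k)) c ->
  supported (fun k => once v n (presimplex_of k)) (diff R G n.+1 c) ->
  exists a, supported (fun k => once v n.+1 (presimplex_of k) /\
    forall u, P u -> once u n.+1 (presimplex_of k)) (c - diff R G n.+2 a).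
Proof.
move=> PV; elim: N c => [|N IHN] c sc sdc.
  exists 0; rewrite linear0 subr0; apply: supported_sub sc => k [lev oP]; split=> //.
  by case: (windowP n.+1 (presimplex_of k)) => // -[p [q [z /lev]]].
have [|a sa] := IHN _ (push_step PV sc sdc).
  by rewrite linearB diff_diff subr0.
by exists (push_op n.+1 c + a); rewrite linearD opprD addrA.
Qed.

Lemma clear_vertex n (P : vertex G -> Prop) (c : chain R G n.+1) :
  (forall u, P u -> VL u /\ u <> v) ->
  supported (fun k => forall u, P u -> once u n.+1 (presimplex_of k)) c ->
  supported (fun k => once v n (presimplex_of k)) (diff R G n.+1 c) ->
  exists a, supported (fun k => once v n.+1 (presimplex_of k) /\
    forall u, P u -> once u n.+1 (presimplex_of k)) (c - diff R G n.+2 a).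
Proof.
(* Positions in an (n+1)-simplex run up to n + 1, so n + 2 strictly bounds every window. *)
move=> PV sc; apply: (@level_iter _ _ n.+2) => //.
apply: supported_sub sc => k oP; split=> // p q z W.
by have := win_le W; case: ifP; lia.
Qed.

End Vertex.

(** The list s holds the vertices that may still be repeated; its head is cleared while those
    outside the list stay clear. *)
Lemma clear_vertices n (s : seq {classic (vertex G)}) (c : chain R G n.+1) :
  supported (fun k => forall u : {classic (vertex G)}, VL u -> u \notin s ->
    once u n.+1 (presimplex_of k)) c ->
  supported (fun k => forall u, VL u -> once u n (presimplex_of k)) (diff R G n.+1 c) ->
  exists a, supported (fun k => forall u, VL u -> once u n.+1 (presimplex_of k))
    (c - diff R G n.+2 a).
Proof.
elim: s c => [|v s IHs] c sc sdc.
  by exists 0; rewrite linear0 subr0; apply: supported_sub sc => k o u VLu; apply: o.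
have [VLv|nVLv] := pselect (VL v); last first.
  apply: IHs => //; apply: supported_sub sc => k o u VLu us; apply: o => //.
  by rewrite inE negb_or us andbT; apply: contra_notN nVLv => /eqP <-.
pose P (u : {classic (vertex G)}) := VL u /\ u \notin v :: s.
have [|||a sa] := @clear_vertex v VLv n P c.
- move=> u [VLu]; rewrite inE negb_or => /andP[uv _]; split=> // e.
  by move: uv; rewrite e eqxx.
- by apply: supported_sub sc => k o u [VLu us]; apply: o.
- by apply: supported_sub sdc => k; apply.
have [||b sb] := IHs (c - diff R G n.+2 a).
- apply: supported_sub sa => k [ov oP] u VLu us.
  have [->//|uv] := eqVneq u v; apply: oP; split=> //.
  by rewrite inE negb_or uv.
- by rewrite linearB diff_diff subr0.
by exists (a + b); rewrite linearD opprD addrA.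
Qed.

Lemma clear_all n (c : chain R G n) :
  supported (fun k => forall u, VL u -> once u n.-1 (presimplex_of k)) (diff R G n c) ->
  exists a, supported (fun k => forall u, VL u -> once u n (presimplex_of k))
    (c - diff R G n.+1 a).
Proof.
case: n c => [|n] c sdc; first by exists 0 => k _ u _ a b; lia.
(* All vertices of the finitely many simplices in c; any other vertex does not occur at all. *)
pose s : seq {classic (vertex G)} :=
  [seq pvert (presimplex_of k) i | k <- enum_fset (msupp c), i <- iota 0 n.+2].
apply: (@clear_vertices _ s) => // k ck u VLu us a b ab ua ub.
case/negP: us; apply/allpairsP; exists (k, a); split=> //.
  by rewrite /= -mcoeff_neq0.
by rewrite mem_iota [(k, a).2]/=; lia.
Qed.

End Insertion.

(** * Loop contractions *)

Lemma sval_injective (T : Type) (P : T -> Prop) : injective (@sval T P).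
Proof. by move=> [x Px] [y Py] /= e; subst y; congr exist; apply: Prop_irrelevance. Qed.

Section RemoveLoops.
Variables (R : comPzRingType) (G : quiver) (L : edge G -> Prop).
Hypothesis degL : forall l, L l -> degenerate_loop l.
Hypothesis degL' : forall l, L l ->
  exists2 l' : edge (remove_edges (fun e => L e /\ e <> l)), sval l' = l & degenerate_loop l'.

Definition loop_vertex (v : vertex G) : Prop := exists2 l, L l & loop_at v l.

Lemma loop_vertexP v : loop_vertex v -> exists l, [/\ L l, loop_at v l,
  forall l', loop_at v l' -> l' = l &
  forall u e, u <> v -> (src e = u /\ tgt e = v) \/ (src e = v /\ tgt e = u) ->
    ~ multiple_edge e].
Proof.
move=> [l Ll lv]; have [v' [lv' uniq_l deg]] := degL Ll; exists l.
have ev : v' = v by rewrite -(proj1 lv) -(proj1 lv').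
by rewrite -ev; split=> // u e uv euv; have [] := deg u e uv euv.
Qed.

Lemma loop_vertex_edge_unique v e e' : loop_vertex v -> src e = v \/ tgt e = v ->
  src e = src e' -> tgt e = tgt e' -> e = e'.
Proof.
move=> /loop_vertexP[l [Ll lv uniq_l deg]] ev ss tt; apply: contrapT => ne.
have mult : multiple_edge e by exists e'; split=> // e'e; apply: ne.
have [loop|nloop] := pselect (src e = v /\ tgt e = v).
  by apply: ne; rewrite (uniq_l e loop) (uniq_l e') // /loop_at -ss -tt.
case: ev => ev.
  by apply: (deg (tgt e) e) => //; [move=> te; apply: nloop|right].
by apply: (deg (src e) e) => //; [move=> se; apply: nloop|left].
Qed.

(** Here degeneracy after removal of the other loops is needed. The edges e and e' are no loops and
    survive, so e is a double edge there and u has a surviving loop m. As m is not at v, it is not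
    in [L]; if u were a loop vertex, its unique loop m would be in [L]. *)
Lemma loop_vertex_between v u e e' : loop_vertex v -> u <> v ->
  src e = v -> tgt e = u -> src e' = u -> tgt e' = v ->
  ~ loop_vertex u /\ exists l, src l = u /\ tgt l = u.
Proof.
move=> [l Ll lv] uv se te se' te'; have [l' l'l [v' [l'v' _ deg]]] := degL' Ll.
have keep x : src x <> tgt x -> ~ (L x /\ x <> l).
  by move=> nx [/degL[w [[sx tx] _ _]] _]; apply: nx; rewrite sx tx.
have ne : src e <> tgt e by rewrite se te => /esym.
have ne' : src e' <> tgt e' by rewrite se' te'.
pose x : edge (remove_edges (fun e => L e /\ e <> l)) := exist _ e (keep _ ne).
pose x' : edge (remove_edges (fun e => L e /\ e <> l)) := exist _ e' (keep _ ne').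
pose u' : vertex (remove_edges (fun e => L e /\ e <> l)) := exist _ u I.
have v'v : sval v' = v by rewrite -(proj1 lv) -l'l -(proj1 l'v').
have u'v' : u' <> v' by move=> /(congr1 sval); rewrite v'v.
have xu : src x = v' /\ tgt x = u'.
  by split; apply: sval_injective; rewrite /= ?v'v.
have [_ [[m [sm tm]]|[]]] := deg u' x u'v' (or_intror xu); last first.
  split; first by move=> /(congr1 sval).
  by exists x'; split; apply: sval_injective; rewrite /= ?se ?te ?se' ?te'.
have mu : loop_at u (sval m).
  by split; [apply: (congr1 sval sm)|apply: (congr1 sval tm)].
split; last by exists (sval m).
move=> /loop_vertexP[l1 [Ll1 _ uniq_l1 _]]; apply: (svalP m).
split; first by rewrite (uniq_l1 _ mu).
by move=> ml; apply: uv; rewrite -(proj1 mu) -(proj1 lv) ml.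
Qed.

Lemma loop_vertex_loop v : loop_vertex v -> exists l, src l = v /\ tgt l = v.
Proof. by move=> [l _ [sl tl]]; exists l. Qed.

Definition inclusion : qhom (remove_edges L) G :=
  @QHom (remove_edges L) G sval sval (fun=> erefl) (fun=> erefl).

Lemma qcomp_inclusion_inj (K : quiver) : injective (@qcomp K _ _ inclusion).
Proof.
move=> f g fg; apply: qhom_ext => x; apply: sval_injective.
  by move/(congr1 (@vmap _ _)) : fg => /(congr1 (fun h => h x)).
by move/(congr1 (@emap _ _)) : fg => /(congr1 (fun h => h x)).
Qed.

Lemma lift_inclusion (K : quiver) (k : qhom K G) : (forall e, ~ L (emap k e)) ->
  exists k', qcomp inclusion k' = k.
Proof.
move=> nL; pose vm x : vertex (remove_edges L) := exist _ (vmap k x) I.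
pose em e : edge (remove_edges L) := exist _ (emap k e) (nL e).
have sm e : src (em e) = vm (src e) by apply: sval_injective; rewrite /= src_emap.
have tm e : tgt (em e) = vm (tgt e) by apply: sval_injective; rewrite /= tgt_emap.
by exists (QHom sm tm); apply: qhom_ext.
Qed.

Lemma inclusion_once n (k : qhom (Delta n) (remove_edges L)) u : loop_vertex u ->
  once u n (presimplex_of (qcomp inclusion k)).
Proof.
move=> /loop_vertexP[l [Ll _ uniq_l _]] a b ab ua ub.
have [x [ex sx tx]] := simplicial_presimplex_of (qcomp inclusion k) ab.
have xl : x = l by apply: uniq_l; split; [rewrite sx|rewrite tx].
move: ex; rewrite /=; case: insubP => //= e _ _ [exk].
by apply: (svalP (emap k e)); rewrite exk xl.
Qed.

Lemma once_lift n (k : qhom (Delta n) G) :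
  (forall u, loop_vertex u -> once u n (presimplex_of k)) ->
  exists k', qcomp inclusion k' = k.
Proof.
move=> o; apply: lift_inclusion => e Le; have [v [[sv tv] _ _]] := degL Le.
have VLv : loop_vertex v by exists (emap k e).
have lt := valP e; have le := ltn_ord (val e).2.
case: (o v VLv (val e).1 (val e).2); first lia.
  by rewrite /= inord_val -sv src_emap.
by rewrite /= inord_val -tv tgt_emap.
Qed.

(** A left inverse of the inclusion on chains. It need not commute with [diff]; boundaries are
    compared in G, through injectivity of the inclusion. *)
Definition retract n : {linear chain R G n -> chain R (remove_edges L) n} :=
  linear_ext (fun k => match pselect (exists k', qcomp inclusion k' = k) with
    | left h => basis (projT1 (cid h))
    | right _ => 0
    end).

Lemma retract_inclusion n (k : qhom (Delta n) (remove_edges L)) :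
  retract n (basis (qcomp inclusion k)) = basis k.
Proof.
rewrite [LHS]linear_ext_basis; case: pselect => [h|[]]; last by exists k.
by case: cid => k' /= /qcomp_inclusion_inj ->.
Qed.

Lemma chain_map_inclusion_inj n : injective (chain_map R inclusion n).
Proof.
have K c : retract n (chain_map R inclusion n c) = c.
  apply: (@eq_linear_basis R _ _ (retract n \o chain_map R inclusion n)%FUN idfun) => k.
  by apply: etrans (congr1 (retract n) (chain_map_basis _ _ _)) (retract_inclusion k).
exact: can_inj K.
Qed.

Lemma chain_map_retract n c :
  supported (fun k => forall u, loop_vertex u -> once u n (presimplex_of k)) c ->
  chain_map R inclusion n (retract n c) = c.
Proof.
move=> sc; apply: (@linear_on_supported _ _ _ _ _
  (chain_map R inclusion n \o retract n)%FUN idfun sc) => k /once_lift[k' <-].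
by apply: etrans (congr1 _ (retract_inclusion k')) (chain_map_basis _ _ _).
Qed.

Lemma supported_inclusion n c :
  supported (fun k => forall u, loop_vertex u -> once u n (presimplex_of k))
    (chain_map R inclusion n c).
Proof.
apply: (@supported_linear _ _ _ (fun=> True)) => // k _.
by rewrite chain_map_basis; apply: supported_basis => u; apply: inclusion_once.
Qed.

(** Injectivity: a chain in G bounded by a cycle of the smaller quiver is cleared without changing
    its boundary. Surjectivity: a cycle of G is itself cleared. *)
Lemma remove_loops_homology : homology_isomorphic R (remove_edges L) G.
Proof.
have clear n c := @clear_all R G loop_vertex loop_vertex_edge_unique
  loop_vertex_between loop_vertex_loop n c.
apply: (qhom_homology_isomorphic (f := inclusion)) => n z dz.
  move=> a' da'; have [|a sa] := clear n.+1 a'.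
    by rewrite [diff _ _ _ _]da'; apply: supported_inclusion.
  exists (retract n.+1 (a' - diff R G n.+2 a)); apply: chain_map_inclusion_inj.
  by rewrite -chain_map_diff chain_map_retract // linearB diff_diff subr0.
have [|a sa] := clear n z; first by rewrite dz; apply: supported0.
exists (retract n (z - diff R G n.+1 a)), a; split.
  apply: chain_map_inclusion_inj; rewrite linear0 -chain_map_diff chain_map_retract //.
  by rewrite linearB dz diff_diff subrr.
by rewrite chain_map_retract // subKr.
Qed.

End RemoveLoops.

Lemma loop_contraction_homology (R : comPzRingType) (G1 G2 : quiver) :
  loop_contraction G1 G2 -> homology_isomorphic R G1 G2.
Proof.
move=> [L [_ degL degL' /(qiso_homology_isomorphic R) iso]].
apply: homology_isomorphic_trans iso _; exact: remove_loops_homology.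
Qed.

Theorem theorem6p5 (R : comPzRingType) (G1 G2 : quiver) :
  wlSh_equivalent G1 G2 ->
  exists phi : forall n : nat,
      {linear quiver_homology R G1 n -> quiver_homology R G2 n},
    forall n : nat, bijective (phi n).
Proof.
move=> eqv; suff iso : homology_isomorphic R G1 G2.
  by exists (fun n => projT1 (cid (iso n))) => n; case: cid.
elim: eqv => [H K [eqvHK|contr|contr]|H|H K _|H K M _ HK _] //.
- exact: lSh_equivalent1_homology.
- exact: loop_contraction_homology.
- by apply: homology_isomorphic_sym; apply: loop_contraction_homology.
- by move=> n; exists idfun; exists id.
- exact: homology_isomorphic_sym.
exact: homology_isomorphic_trans.
Qed.
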